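(* Let $\mathfrak g$ be one of $\mathfrak{so}_{2n+1}$, $\mathfrak{so}_{2n}$, $\mathfrak{sp}_{2n}$. The algebra $U_{r,s}(\mathfrak g)$ (defined by generators and relations in the context) is a Hopf algebra under the comultiplication $\Delta$, counit $\varepsilon$ and antipode $S$ given on generators, for $1\le i\le n$, by $$\Delta(\omega_i^{\pm1})=\omega_i^{\pm1}\otimes\omega_i^{\pm1},\quad \Delta(\omega_i'^{\pm1})=\omega_i'^{\pm1}\otimes\omega_i'^{\pm1},\quad \Delta(e_i)=e_i\otimes 1+\omega_i\otimes e_i,\quad \Delta(f_i)=1\otimes f_i+f_i\otimes\omega_i',$$ $$\varepsilon(\omega_i^{\pm1})=\varepsilon(\omega_i'^{\pm1})=1,\qquad \varepsilon(e_i)=\varepsilon(f_i)=0,$$ $$S(\omega_i^{\pm1})=\omega_i^{\mp1},\quad S(\omega_i'^{\pm1})=\omega_i'^{\mp1},\quad S(e_i)=-\omega_i^{-1}e_i,\quad S(f_i)=-f_i\,\omega_i'^{-1}.$$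
   Context: Base field: $\mathbb K=\mathbb Q(r,s)$, where $r,s$ are either two indeterminates, or nonzero parameters in $\mathbb C$ with $r^2\ne s^2$. Roots: $\epsilon_1,\dots,\epsilon_n$ is an orthonormal basis of $\mathbb R^n$ with inner product $(\,,)$; the simple roots are $\alpha_i=\epsilon_i-\epsilon_{i+1}$ for $1\le i<n$, and $\alpha_n=\epsilon_n$ for $\mathfrak{so}_{2n+1}$ (type $B_n$, $n\ge2$), $\alpha_n=2\epsilon_n$ for $\mathfrak{sp}_{2n}$ (type $C_n$, $n\ge 2$), $\alpha_n=\epsilon_{n-1}+\epsilon_n$ for $\mathfrak{so}_{2n}$ (type $D_n$, $n\ge4$). Let $a_{ij}=2(\alpha_i,\alpha_j)/(\alpha_i,\alpha_i)$. Put $r_i=r^{(\alpha_i,\alpha_i)}$, $s_i=s^{(\alpha_i,\alpha_i)}$ in type $B$ (so $r_i=r^2,s_i=s^2$ for $i<n$, $r_n=r,s_n=s$), and $r_i=r^{(\alpha_i,\alpha_i)/2}$, $s_i=s^{(\alpha_i,\alpha_i)/2}$ in types $C,D$ (so in type $C$: $r_i=r$, $s_i=s$ for $i<n$, $r_n=r^2$, $s_n=s^2$; in type $D$: $r_i=r$, $s_i=s$). Structure constants $p_{ij}$, $1\le i,j\le n$: Type $B$: $p_{ij}=r^{2(\epsilon_j,\alpha_i)}s^{2(\epsilon_{j+1},\alpha_i)}$ if $j<n$; $p_{in}=r^{2(\epsilon_n,\alpha_i)}$ if $i<n$; $p_{nn}=rs^{-1}$. Type $C$: $p_{ij}=r^{(\epsilon_j,\alpha_i)}s^{(\epsilon_{j+1},\alpha_i)}$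 if $j<n$; $p_{in}=r^{2(\epsilon_n,\alpha_i)}$ if $i<n$; $p_{nn}=r^2s^{-2}$. Type $D$: $p_{ij}=r^{(\epsilon_j,\alpha_i)}s^{(\epsilon_{j+1},\alpha_i)}$ if $j<n$; $p_{in}=r^{(\epsilon_{n-1},\alpha_i)}s^{-(\epsilon_n,\alpha_i)}$ if $i\ne n-1$; $p_{n-1,n}=r^{-1}s^{-1}$. $U_{r,s}(\mathfrak g)$ is the unital associative $\mathbb K$-algebra generated by $e_i,f_i,\omega_i^{\pm1},\omega_i'^{\pm1}$ ($1\le i\le n$) subject to: (1) the $\omega_i^{\pm1},\omega_j'^{\pm1}$ all commute and $\omega_i\omega_i^{-1}=\omega_j'\omega_j'^{-1}=1$; (2) $\omega_je_i\omega_j^{-1}=p_{ij}e_i$, $\ \omega_jf_i\omega_j^{-1}=p_{ij}^{-1}f_i$; (3) $\omega_j'e_i\omega_j'^{-1}=p_{ji}^{-1}e_i$, $\ \omega_j'f_i\omega_j'^{-1}=p_{ji}f_i$; (4) $[e_i,f_j]=\delta_{ij}\dfrac{\omega_i-\omega_i'}{r_i-s_i}$; (5) ($e$-Serre relations) Types $B,C$: $[e_i,e_j]=0$ for $|i-j|>1$. Type $D$: $[e_i,e_j]=0$ for $i\neq j$ with $a_{ij}=0$ and $\{i,j\}\ne\{n-1,n\}$, and $e_{n-1}e_n=rs\,e_ne_{n-1}$. Type $B$: $e_i^2e_{i+1}-(r_i+s_i)e_ie_{i+1}e_i+r_is_i\,e_{i+1}e_i^2=0$ for $1\le i<n$; $e_{j+1}^2e_j-(r_{j+1}^{-1}+s_{j+1}^{-1})e_{j+1}e_je_{j+1}+r_{j+1}^{-1}s_{j+1}^{-1}e_je_{j+1}^2=0$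 for $1\le j<n-1$; $e_n^3e_{n-1}-(r^{-2}+r^{-1}s^{-1}+s^{-2})e_n^2e_{n-1}e_n+r^{-1}s^{-1}(r^{-2}+r^{-1}s^{-1}+s^{-2})e_ne_{n-1}e_n^2-r^{-3}s^{-3}e_{n-1}e_n^3=0$. Type $C$: for $1\le i<n-1$, $e_i^2e_{i+1}-(r+s)e_ie_{i+1}e_i+rs\,e_{i+1}e_i^2=0$ and $e_{i+1}^2e_i-(r^{-1}+s^{-1})e_{i+1}e_ie_{i+1}+r^{-1}s^{-1}e_ie_{i+1}^2=0$; $e_{n-1}^3e_n-(r^2+rs+s^2)e_{n-1}^2e_ne_{n-1}+rs(r^2+rs+s^2)e_{n-1}e_ne_{n-1}^2-(rs)^3e_ne_{n-1}^3=0$; $e_n^2e_{n-1}-(r^{-2}+s^{-2})e_ne_{n-1}e_n+r^{-2}s^{-2}e_{n-1}e_n^2=0$. Type $D$: for $1\le i<j\le n$ with $a_{ij}=-1$, $e_i^2e_j-(r+s)e_ie_je_i+rs\,e_je_i^2=0$ and $e_j^2e_i-(r^{-1}+s^{-1})e_je_ie_j+r^{-1}s^{-1}e_ie_j^2=0$. (6) ($f$-Serre relations) each relation in (5) with every word reversed and every $e_k$ replaced by $f_k$ (e.g. $f_nf_{n-1}=rs\,f_{n-1}f_n$ in type $D$). *)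

(* Defs.v *)
From HB Require Import structures.
From mathcomp Require Import all_boot all_order all_algebra.
From mathcomp Require Import boolp classical_sets reals complex.
From mathcomp Require Import finmap xfinmap monalg.

Set Implicit Arguments.
Unset Strict Implicit.
Unset Printing Implicit Defensive.

Import GRing.Theory BigEnoughFSet.
Local Open Scope fset_scope.
Local Open Scope ring_scope.
Local Open Scope quotient_scope.

Section Span.
Variables (K : fieldType) (V : lmodType K) (S : V -> Prop).

Inductive in_span : V -> Prop :=
| span_gen x of S x : in_span x
| span_0 : in_span 0
| span_D x y of in_span x & in_span y : in_span (x + y)
| span_Z c x of in_span x : in_span (c *: x).

Definition span (x : V) : bool := `[< in_span x >].

Lemma spanP x : reflect (in_span x) (x \in span).
Proof. exact: asboolP. Qed.

Lemma span_submod_closed : submod_closed span.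
Proof.
split=> [|c x y /spanP Sx /spanP Sy]; apply/spanP; first exact: span_0.
by apply: span_D => //; apply: span_Z.
Qed.

HB.instance Definition _ := GRing.isSubmodClosed.Build K V span
  span_submod_closed.

Definition span_closed : zmodClosed V := GRing.ZmodClosed.clone V span _.

Lemma span_killed (W : lmodType K) (f : {linear V -> W}) x :
  (forall y, S y -> f y = 0) -> x \in span -> f x = 0.
Proof.
move=> fS /spanP; elim=> {x} [x /fS //||x y _ fx _ fy|c x _ fx].
- exact: linear0.
- by rewrite linearD fx fy addr0.
- by rewrite linearZ /= fx scaler0.
Qed.

End Span.

Section QuotientModule.
Variables (K : fieldType) (V : lmodType K) (S : V -> Prop).

Definition mod_quot := Quotient.quot (span_closed S).
Local Notation Q := mod_quot.

HB.instance Definition _ := GRing.Zmodule.on Q.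

Definition mod_pi (x : V) : Q := \pi_(Quotient.quot (span_closed S)) x.
Definition mod_repr (x : Q) : V := repr (x : Quotient.quot (span_closed S)).

Lemma mod_reprK (x : Q) : mod_pi (mod_repr x) = x.
Proof. exact: reprK. Qed.

Lemma mod_piP (x y : V) : mod_pi x = mod_pi y <-> x - y \in span S.
Proof.
have := Quotient.idealrBE (span_closed S) x y.
by rewrite /= => E; split=> [/eqP|]; [rewrite -E | move=> xy; apply/eqP; rewrite -E].
Qed.

Lemma mod_reprP (x : V) : mod_repr (mod_pi x) - x \in span S.
Proof. by apply/mod_piP; rewrite mod_reprK. Qed.

Lemma mod_pi0 : mod_pi 0 = 0.
Proof. by rewrite /mod_pi !piE. Qed.

Lemma mod_piD (x y : V) : mod_pi (x + y) = mod_pi x + mod_pi y.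
Proof. by rewrite /mod_pi !piE. Qed.

Definition mod_scale (c : K) (x : Q) : Q := mod_pi (c *: mod_repr x).

Lemma mod_scaleE c (x : V) : mod_scale c (mod_pi x) = mod_pi (c *: x).
Proof. by apply/mod_piP; rewrite -scalerBr rpredZ ?mod_reprP. Qed.

Fact mod_scaleA a b x : mod_scale a (mod_scale b x) = mod_scale (a * b) x.
Proof. by rewrite -[x]mod_reprK !mod_scaleE scalerA. Qed.

Fact mod_scale1 : left_id 1 mod_scale.
Proof. by move=> x; rewrite -[x]mod_reprK !mod_scaleE scale1r. Qed.

Fact mod_scaleDr : right_distributive mod_scale +%R.
Proof.
move=> c x y; rewrite -[x]mod_reprK -[y]mod_reprK -mod_piD !mod_scaleE.
by rewrite -mod_piD scalerDr.
Qed.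

Fact mod_scaleDl x : {morph mod_scale^~ x : a b / a + b}.
Proof.
by move=> a b; rewrite -[x]mod_reprK !mod_scaleE -mod_piD scalerDl.
Qed.

HB.instance Definition _ := GRing.Zmodule_isLmodule.Build K Q
  mod_scaleA mod_scale1 mod_scaleDr mod_scaleDl.

Fact mod_pi_linear : linear mod_pi.
Proof. by move=> c x y; rewrite mod_piD -mod_scaleE. Qed.

HB.instance Definition _ := GRing.isLinear.Build K V Q _ mod_pi mod_pi_linear.

End QuotientModule.

Section Ideal.
Variables (K : fieldType) (A : algType K) (S : A -> Prop).

Definition two_sided_multiple (y : A) : Prop :=
  exists a x b, S x /\ y = a * x * b.

Definition ideal : A -> bool := span two_sided_multiple.

HB.instance Definition _ := GRing.SubmodClosed.on ideal.

Lemma ideal_mull a x : x \in ideal -> a * x \in ideal.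
Proof.
move=> /spanP xI; apply/spanP; elim: xI => {x}.
- move=> _ [b [x [c [Sx ->]]]]; apply: span_gen.
  by exists (a * b), x, c; rewrite !mulrA.
- by rewrite mulr0; apply: span_0.
- by move=> x y _ ax _ ay; rewrite mulrDr; apply: span_D.
- by move=> c x _ ax; rewrite -scalerAr; apply: span_Z.
Qed.

Lemma ideal_mulr a x : x \in ideal -> x * a \in ideal.
Proof.
move=> /spanP xI; apply/spanP; elim: xI => {x}.
- move=> _ [b [x [c [Sx ->]]]]; apply: span_gen.
  by exists b, x, (c * a); rewrite !mulrA.
- by rewrite mul0r; apply: span_0.
- by move=> x y _ ax _ ay; rewrite mulrDl; apply: span_D.
- by move=> c x _ ax; rewrite -scalerAl; apply: span_Z.
Qed.

Lemma ideal_killed (B : algType K) (f : {lrmorphism A -> B}) x :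
  (forall y, S y -> f y = 0) -> x \in ideal -> f x = 0.
Proof.
move=> fS; apply: (span_killed (f := f)) => _ [a [y [b [Sy ->]]]].
have /= fy := fS _ Sy; by rewrite /= !rmorphM /= fy mulr0 mul0r.
Qed.

Lemma ideal_proper (B : algType K) (f : {lrmorphism A -> B}) :
  (forall y, S y -> f y = 0) -> 1 \notin ideal.
Proof.
move=> fS; apply/negP => /(ideal_killed fS) /eqP.
by rewrite rmorph1 oner_eq0.
Qed.

End Ideal.

(* The quotient of A by the two-sided ideal generated by S.  The properness   *)
(* argument only serves to meet the requirement 1 != 0 of [algType].          *)
Definition alg_quot (K : fieldType) (A : algType K) (S : A -> Prop)
  (proper : 1 \notin ideal S) := mod_quot (two_sided_multiple S).

Section AlgPi.
Variables (K : fieldType) (A : algType K) (S : A -> Prop).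
Variable proper : 1 \notin ideal S.
Local Notation Q := (alg_quot proper).

HB.instance Definition _ := GRing.Lmodule.on Q.

Definition alg_pi (x : A) : Q := mod_pi (two_sided_multiple S) x.
Definition alg_repr (x : Q) : A := mod_repr x.

End AlgPi.

HB.lock Definition alg_quot_mul (K : fieldType) (A : algType K) (S : A -> Prop)
    (proper : 1 \notin ideal S) (x y : alg_quot proper) : alg_quot proper :=
  alg_pi proper (alg_repr x * alg_repr y).

Section QuotientAlgebra.
Variables (K : fieldType) (A : algType K) (S : A -> Prop).
Variable proper : 1 \notin ideal S.
Local Notation Q := (alg_quot proper).
Local Notation alg_pi := (alg_pi proper).
Local Notation alg_quot_mul := (@alg_quot_mul K A S proper).

Lemma alg_reprK (x : Q) : alg_pi (alg_repr x) = x.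
Proof. exact: mod_reprK. Qed.

Lemma alg_piP x y : alg_pi x = alg_pi y <-> x - y \in ideal S.
Proof. exact: mod_piP. Qed.

Lemma alg_quot_mulE x y : alg_quot_mul (alg_pi x) (alg_pi y) = alg_pi (x * y).
Proof.
rewrite alg_quot_mul.unlock.
apply/alg_piP; rewrite -(subrKA (x * alg_repr (alg_pi y))) -mulrBl -mulrBr.
rewrite rpredD //; first by apply: ideal_mulr; apply: mod_reprP.
by apply: ideal_mull; apply: mod_reprP.
Qed.

Lemma alg_piD x y : alg_pi (x + y) = alg_pi x + alg_pi y.
Proof. exact: mod_piD. Qed.

Lemma alg_piZ (c : K) (x : A) : alg_pi (c *: x) = c *: alg_pi x.
Proof. exact: linearZ. Qed.

Fact alg_quot_mulA : associative alg_quot_mul.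
Proof.
move=> x y z; rewrite -[x]alg_reprK -[y]alg_reprK -[z]alg_reprK.
by rewrite !alg_quot_mulE mulrA.
Qed.

Fact alg_quot_mul1 : left_id (alg_pi 1) alg_quot_mul.
Proof. by move=> x; rewrite -[x]alg_reprK alg_quot_mulE mul1r. Qed.

Fact alg_quot_mulr1 : right_id (alg_pi 1) alg_quot_mul.
Proof. by move=> x; rewrite -[x]alg_reprK alg_quot_mulE mulr1. Qed.

Fact alg_quot_mulDl : left_distributive alg_quot_mul +%R.
Proof.
move=> x y z; rewrite -[x]alg_reprK -[y]alg_reprK -[z]alg_reprK.
by rewrite -alg_piD !alg_quot_mulE -alg_piD mulrDl.
Qed.

Fact alg_quot_mulDr : right_distributive alg_quot_mul +%R.
Proof.
move=> x y z; rewrite -[x]alg_reprK -[y]alg_reprK -[z]alg_reprK.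
by rewrite -alg_piD !alg_quot_mulE -alg_piD mulrDr.
Qed.

Fact alg_quot1_neq0 : alg_pi 1 != 0.
Proof.
apply: contra proper => /eqP; rewrite -[0 in RHS]mod_pi0 => /alg_piP.
by rewrite subr0.
Qed.

HB.instance Definition _ := GRing.Zmodule_isNzRing.Build Q
  alg_quot_mulA alg_quot_mul1 alg_quot_mulr1 alg_quot_mulDl alg_quot_mulDr
  alg_quot1_neq0.

Lemma alg_piM x y : alg_pi (x * y) = alg_pi x * alg_pi y.
Proof. by rewrite -alg_quot_mulE. Qed.

Fact alg_quot_scaleAl (c : K) (x y : Q) : c *: (x * y) = (c *: x) * y.
Proof.
rewrite -[x]alg_reprK -[y]alg_reprK.
by rewrite -alg_piZ -!alg_piM -alg_piZ scalerAl.
Qed.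

HB.instance Definition _ := GRing.Lmodule_isLalgebra.Build K Q
  alg_quot_scaleAl.

Fact alg_quot_scaleAr (c : K) (x y : Q) : c *: (x * y) = x * (c *: y).
Proof.
rewrite -[x]alg_reprK -[y]alg_reprK.
by rewrite -alg_piZ -!alg_piM -alg_piZ scalerAr.
Qed.

HB.instance Definition _ := GRing.Lalgebra_isAlgebra.Build K Q
  alg_quot_scaleAr.

Fact alg_pi_linear : linear alg_pi.
Proof. by move=> c x y; rewrite alg_piD alg_piZ. Qed.

Fact alg_pi_monoid_morphism : monoid_morphism alg_pi.
Proof. by split=> // x y; rewrite alg_piM. Qed.

HB.instance Definition _ := GRing.isLinear.Build K A Q _ alg_pi alg_pi_linear.
HB.instance Definition _ := GRing.isMonoidMorphism.Build A Q alg_pi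
  alg_pi_monoid_morphism.

End QuotientAlgebra.

(* K<X>, the K-algebra of the free monoid on X.  Its product is the one of    *)
(* [monalg], sealed to keep unification from unfolding it.                     *)
Definition free_alg (K : fieldType) (X : choiceType) := {malg K[{fmonom X}]}.

HB.lock Definition free_mul (K : fieldType) (X : choiceType)
  (x y : {malg K[{fmonom X}]}) : {malg K[{fmonom X}]} := x * y.

Section FreeAlgebra.
Variables (K : fieldType) (X : choiceType).
Local Notation F := (free_alg K X).
Local Notation mul := (@free_mul K X).

HB.instance Definition _ := GRing.Lmodule.on F.

Fact free_mulA : associative mul.
Proof. by rewrite free_mul.unlock; exact: mulrA. Qed.

Fact free_mul1 : left_id (1 : {malg K[{fmonom X}]}) mul.
Proof. by rewrite free_mul.unlock; exact: mul1r. Qed.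

Fact free_mulr1 : right_id (1 : {malg K[{fmonom X}]}) mul.
Proof. by rewrite free_mul.unlock; exact: mulr1. Qed.

Fact free_mulDl : left_distributive mul +%R.
Proof. by rewrite free_mul.unlock; exact: mulrDl. Qed.

Fact free_mulDr : right_distributive mul +%R.
Proof. by rewrite free_mul.unlock; exact: mulrDr. Qed.

Fact free_1_neq0 : (1 : {malg K[{fmonom X}]}) != 0.
Proof. exact: oner_neq0. Qed.

HB.instance Definition _ := GRing.Zmodule_isNzRing.Build F
  free_mulA free_mul1 free_mulr1 free_mulDl free_mulDr free_1_neq0.

Fact free_scaleAl (c : K) (x y : F) : c *: mul x y = mul (c *: x) y.
Proof. by rewrite free_mul.unlock; exact: fgscaleAl. Qed.

HB.instance Definition _ := GRing.Lmodule_isLalgebra.Build K F free_scaleAl.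

Fact free_scaleAr (c : K) (x y : F) : c *: mul x y = mul x (c *: y).
Proof.
rewrite free_mul.unlock; apply/malgP => k; rewrite mcoeffZ mcoeffMl.
rewrite (mcoeffMlw _ (fsubset_refl _) (msuppZ_le c y)) mulr_sumr.
apply: eq_bigr => k1 _; rewrite mulr_sumr; apply: eq_bigr => k2 _.
by rewrite mcoeffZ mulrnAr mulrCA.
Qed.

HB.instance Definition _ := GRing.Lalgebra_isAlgebra.Build K F free_scaleAr.

End FreeAlgebra.

HB.lock Definition free_var (K : fieldType) (X : choiceType) (x : X)
  : free_alg K X := << fmu x >>.

Section WordEval.
Variables (K : fieldType) (X : choiceType) (A : algType K) (g : X -> A).

Definition word_eval (w : {fmonom X}) : A := \prod_(x <- (w : seq X)) g x.

Fact word_eval_mmorphism : mmorphism word_eval.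
Proof.
split=> [u v|]; last by rewrite /word_eval fm1 big_nil.
by rewrite /word_eval [mmul u v](fmmulE u v) big_cat.
Qed.

HB.instance Definition _ := isMultiplicative.Build _ A word_eval
  word_eval_mmorphism.

End WordEval.

(* The algebra morphism sending the variable x to g x *)
HB.lock Definition free_eval (K : fieldType) (X : choiceType) (A : algType K)
    (g : X -> A) (p : free_alg K X) : A := mmap (in_alg A) (word_eval g) p.

Section FreeEval.
Variables (K : fieldType) (X : choiceType) (A : algType K) (g : X -> A).
Local Notation free_eval := (@free_eval K X A g).
Local Notation word_eval := (@word_eval K X A g).

Fact free_eval_monoid_morphism : monoid_morphism free_eval.
Proof.
have [] := @commr_mmap_is_multiplicative {fmonom X} K A (in_alg A) word_eval.
  by move=> p u v; rewrite /GRing.comm /= mulr_algl mulr_algr.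
move=> M o; rewrite free_eval.unlock; split=> // p q.
by rewrite {1}/GRing.mul /= free_mul.unlock M.
Qed.

Fact free_eval_linear : linear free_eval.
Proof.
move=> c p q; rewrite free_eval.unlock raddfD; congr (_ + _).
rewrite -[c *: mmap _ _ p]mulr_algl.
exact: (@mmapZ {fmonom X} K A (in_alg A) word_eval c p).
Qed.

HB.instance Definition _ := GRing.isLinear.Build K (free_alg K X) A _ free_eval
  free_eval_linear.
HB.instance Definition _ := GRing.isMonoidMorphism.Build (free_alg K X) A free_eval
  free_eval_monoid_morphism.

Lemma free_eval_var x : free_eval (free_var K x) = g x.
Proof.
by rewrite free_eval.unlock free_var.unlock mmapU /= scale1r mul1r /word_eval fmuE big_seq1.
Qed.

End FreeEval.

Section Tensor.
Variables (K : fieldType) (V W : lmodType K).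

Inductive tensor_relation : {malg K[(V * W)%type]} -> Prop :=
| tensor_addl v v' w :
    tensor_relation (<< (v + v', w) >> - << (v, w) >> - << (v', w) >>)
| tensor_addr v w w' :
    tensor_relation (<< (v, w + w') >> - << (v, w) >> - << (v, w') >>)
| tensor_scalel c v w :
    tensor_relation (<< (c *: v, w) >> - c *: << (v, w) >>)
| tensor_scaler c v w :
    tensor_relation (<< (v, c *: w) >> - c *: << (v, w) >>).

Definition tensor := mod_quot tensor_relation.

HB.instance Definition _ := GRing.Lmodule.on tensor.

End Tensor.

HB.lock Definition tens (K : fieldType) (V W : lmodType K) (v : V) (w : W)
  : tensor V W := mod_pi (@tensor_relation K V W) << (v, w) >>.

Section TensorTheory.
Variables (K : fieldType) (V W : lmodType K).
Implicit Types (v : V) (w : W).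
Local Notation tensor := (tensor V W).
Local Notation tensor_relation := (@tensor_relation K V W).

Lemma tensDl v v' w : tens (v + v') w = tens v w + tens v' w.
Proof.
rewrite !tens.unlock -mod_piD; apply/mod_piP; rewrite opprD addrA.
by apply/spanP/span_gen; exact: tensor_addl.
Qed.

Lemma tensDr v w w' : tens v (w + w') = tens v w + tens v w'.
Proof.
rewrite !tens.unlock -mod_piD; apply/mod_piP; rewrite opprD addrA.
by apply/spanP/span_gen; exact: tensor_addr.
Qed.

Lemma tensZl (c : K) v w : tens (c *: v) w = c *: tens v w.
Proof.
rewrite !tens.unlock -[RHS]linearZ; apply/mod_piP.
by apply/spanP/span_gen; exact: tensor_scalel.
Qed.

Lemma tensZr (c : K) v w : tens v (c *: w) = c *: tens v w.
Proof.
rewrite !tens.unlock -[RHS]linearZ; apply/mod_piP.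
by apply/spanP/span_gen; exact: tensor_scaler.
Qed.

Lemma tens_ind (P : tensor -> Prop) :
  P 0 -> (forall t u, P t -> P u -> P (t + u)) ->
  (forall v w, P (tens v w)) -> forall t, P t.
Proof.
move=> P0 PD Pt t; rewrite -[t]mod_reprK [mod_repr t]monalgE raddf_sum /=.
elim/big_ind: _ => // -[v w] _; set c := mcoeff _ _.
suff -> : << c *g (v, w) >> = c *: << (v, w) >> :> {malg K[(V * W)%type]}.
  have -> // : mod_pi tensor_relation (c *: << (v, w) >>) = tens (c *: v) w.
  by rewrite tensZl tens.unlock; exact: linearZ.
by apply/malgP => k; rewrite mcoeffZ !mcoeffU mulrnAr mulr1.
Qed.

Section Lift.
Variables (U : lmodType K).
Implicit Types f : V -> W -> U.

Definition malg_lift f (g : {malg K[(V * W)%type]}) : U :=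
  \sum_(k <- msupp g) g@_k *: f k.1 k.2.

Lemma malg_liftE f g (d : {fset (V * W)%type}) : (msupp g `<=` d)%fset ->
  malg_lift f g = \sum_(k <- d) g@_k *: f k.1 k.2.
Proof.
move=> le; rewrite [LHS](big_fset_incl _ le) => //= x xd /mcoeff_outdom ->.
by rewrite scale0r.
Qed.

Fact malg_lift_linear f : linear (malg_lift f).
Proof.
move=> c g1 g2; pose_big_fset (V * W)%type E.
rewrite !(malg_liftE f (d := E)) //.
  rewrite scaler_sumr -big_split /=; apply: eq_bigr => k _.
  by rewrite mcoeffD mcoeffZ scalerDl scalerA.
by close.
Qed.

HB.instance Definition _ f := GRing.isLinear.Build K {malg K[(V * W)%type]} U _
  (malg_lift f) (malg_lift_linear f).

Lemma malg_liftU f v w : malg_lift f << (v, w) >> = f v w.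
Proof.
by rewrite (malg_liftE _ msuppU_le) big_seq_fset1 mcoeffUU scale1r.
Qed.

Definition bilinear_map f : Prop :=
  (forall w, linear (f^~ w)) /\ (forall v, linear (f v)).

End Lift.
End TensorTheory.

(* The linear map V ⊗ W -> U with v ⊗ w |-> f v w; meaningful when f is        *)
(* bilinear, see tens_liftE and tens_lift_linear below.                        *)
HB.lock Definition tens_lift (K : fieldType) (V W U : lmodType K)
    (f : V -> W -> U) (t : tensor V W) : U :=
  malg_lift f (mod_repr t).

Section TensorLift.
Variables (K : fieldType) (V W U : lmodType K).
Implicit Types f : V -> W -> U.
Local Notation tensor_relation := (@tensor_relation K V W).

Lemma tens_lift_pi f : bilinear_map f ->
  forall g, tens_lift f (mod_pi tensor_relation g) = malg_lift f g.
Proof.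
move=> [fl fr] g; apply/eqP; rewrite tens_lift.unlock -subr_eq0 -linearB; apply/eqP.
apply: (span_killed _ (mod_reprP tensor_relation g)) => y.
have addl w v v' : f (v + v') w = f v w + f v' w.
  by have := fl w 1 v v'; rewrite !scale1r.
have addr v w w' : f v (w + w') = f v w + f v w'.
  by have := fr v 1 w w'; rewrite !scale1r.
have f0l w : f 0 w = 0.
  by have := addl w 0 0; rewrite addr0 -[LHS]addr0 => /addrI <-.
have f0r v : f v 0 = 0.
  by have := addr v 0 0; rewrite addr0 -[LHS]addr0 => /addrI <-.
case=> [v v' w|v w w'|c v w|c v w]; rewrite !linearB /= ?linearZ /= !malg_liftU.
- by rewrite addl addrAC addrK subrr.
- by rewrite addr addrAC addrK subrr.
- by have := fl w c v 0; rewrite /= f0l !addr0 => ->; rewrite scalerN subrr.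
- by have := fr v c w 0; rewrite f0r !addr0 => ->; rewrite scalerN subrr.
Qed.

Lemma tens_liftE f : bilinear_map f ->
  forall v w, tens_lift f (tens v w) = f v w.
Proof. by move=> bf v w; rewrite tens.unlock tens_lift_pi // malg_liftU. Qed.

Lemma tens_lift_linear f : bilinear_map f -> linear (tens_lift f).
Proof.
move=> bf c t u; rewrite -[t]mod_reprK -[u]mod_reprK.
have <- := linearP (mod_pi tensor_relation) c (mod_repr t) (mod_repr u).
by rewrite !tens_lift_pi // linearP.
Qed.

Lemma tens_liftZ f : bilinear_map f ->
  forall (c : K) t, tens_lift f (c *: t) = c *: tens_lift f t.
Proof.
move=> bf c t; rewrite -[t]mod_reprK.
have <- : mod_pi tensor_relation (c *: mod_repr t)
  = c *: mod_pi tensor_relation (mod_repr t) by exact: linearZ.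
by rewrite !tens_lift_pi // linearZ.
Qed.

Lemma tens_lift_linearl (c : K) f g h t :
  (forall v w, h v w = c *: f v w + g v w) ->
  tens_lift h t = c *: tens_lift f t + tens_lift g t.
Proof.
move=> E; rewrite tens_lift.unlock /malg_lift scaler_sumr -big_split /=.
apply: eq_bigr => k _; rewrite E scalerDr !scalerA.
by rewrite [c * _]mulrC.
Qed.

End TensorLift.

Arguments tensor {K} (V W)%_type_scope.
Notation "V ⊗ W" := (tensor V W) (at level 40, left associativity) : type_scope.
Notation "v ⊗ w" := (tens v w) (at level 40, left associativity) : ring_scope.

Section UnitFunctional.
Variables (K : fieldType) (V : lmodType K).
Local Open Scope classical_set_scope.

Lemma separating_functional (e : V) :
  e != 0 -> exists phi : V -> K, scalar phi /\ phi e = 1.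
Proof.
move=> e0.
pose P (M : set V) :=
  (forall c x y, M x -> M y -> M (c *: x + y)) /\ ~ M e.
have [|M [[Ml Me] Mmax]] := @Zorn_bigcup V P.
  move=> F FP Ftot; split; last by move=> [X FX Xe]; exact: (FP X FX).2.
  move=> c x y [X FX Xx] [Y FY Yy]; case: (Ftot X Y FX FY) => [XY|YX].
    by exists Y => //; apply: (FP Y FY).1 => //; apply: XY.
  by exists X => //; apply: (FP X FX).1 => //; apply: YX.
have M0 : M 0.
  apply: contrapT => nM0; apply: (Mmax [set 0]).
    split=> [x Mx|]; last by move=> /(_ 0 erefl).
    by case: nM0; have := Ml (-1) x x Mx Mx; rewrite scaleN1r addNr.
  split=> [c x y -> ->|/= /eqP]; first by rewrite /= scaler0 addr0.
  exact/negP.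
have MZ c x : M x -> M (c *: x) by move=> Mx; rewrite -[_ *: _]addr0; exact: Ml.
have MD x y : M x -> M y -> M (x + y).
  by move=> Mx My; rewrite -[x]scale1r; exact: Ml.
have ex x : exists c, M (x - c *: e).
  apply: contrapT => nex.
  have nMx : ~ M x by move=> Mx; apply: nex; exists 0; rewrite scale0r subr0.
  apply: (Mmax [set y | exists d, M (y - d *: x)]).
    split=> [y My|BM]; first by exists 0; rewrite scale0r subr0.
    by apply/nMx/BM; exists 1; rewrite scale1r subrr.
  split=> [c y z [d Md] [d' Md']|[d Md]].
    exists (c * d + d'); have := Ml c _ _ Md Md'.
    by rewrite scalerBr addrACA -opprD scalerA -scalerDl.
  have d0 : d != 0 by apply/eqP => d0; apply: Me; move: Md; rewrite d0 scale0r subr0.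
  apply: nex; exists d^-1; have := MZ (- d^-1) _ Md.
  by rewrite scalerBr !scaleNr scalerA mulVf // scale1r opprK addrC.
have uniq x c d : M (x - c *: e) -> M (x - d *: e) -> c = d.
  move=> Mc Md; apply/eqP; rewrite -subr_eq0; apply/negPn/negP => cd.
  have E : x - d *: e + -1 *: (x - c *: e) = (c - d) *: e.
    by rewrite scaleN1r opprB addrC addrA subrK -scalerBl.
  apply: Me; have := MZ (c - d)^-1 _ (MD _ _ Md (MZ (-1) _ Mc)).
  by rewrite E scalerA mulVf // scale1r.
pose phi x := projT1 (cid (ex x)).
have phiP x : M (x - phi x *: e) := projT2 (cid (ex x)).
exists phi; split=> [c x y|]; last by apply: (uniq e) => //; rewrite scale1r subrr.
apply: (uniq (c *: x + y)) => //.
have := Ml c _ _ (phiP x) (phiP y).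
by rewrite scalerBr addrACA -opprD scalerA -scalerDl.
Qed.

End UnitFunctional.

HB.lock Definition tens_mul (K : fieldType) (A B : algType K) (t u : A ⊗ B)
    : A ⊗ B :=
  tens_lift (fun a b => tens_lift (fun c d => (a * c) ⊗ (b * d)) u) t.

Section TensorAlgebra.
Variables (K : fieldType) (A B : algType K).
Local Notation T := (A ⊗ B)%type.
Local Notation tens_mul := (@tens_mul K A B).

Fact tens_mul_inner a b :
  bilinear_map (fun c d => (a * c) ⊗ (b * d) : T).
Proof.
split=> [d|c] k x y /=.
  by rewrite mulrDr -scalerAr tensDl tensZl.
by rewrite mulrDr -scalerAr tensDr tensZr.
Qed.

Fact tens_mul_outer (u : T) :
  bilinear_map (fun a b => tens_lift (fun c d => (a * c) ⊗ (b * d) : T) u).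
Proof.
split=> [b|a] k x y /=; apply: tens_lift_linearl => c d.
  by rewrite mulrDl -scalerAl tensDl tensZl.
by rewrite mulrDl -scalerAl tensDr tensZr.
Qed.

Lemma tens_mulE a b c d : tens_mul (a ⊗ b) (c ⊗ d) = (a * c) ⊗ (b * d).
Proof.
by rewrite tens_mul.unlock tens_liftE ?tens_liftE //;
  [exact: tens_mul_inner | exact: tens_mul_outer].
Qed.

Fact tens_mulDl : left_distributive tens_mul +%R.
Proof.
move=> t t' u; rewrite tens_mul.unlock; have := tens_lift_linear (tens_mul_outer u) 1 t t'.
by rewrite !scale1r.
Qed.

Fact tens_mul_linearr (k : K) (t u u' : T) :
  tens_mul t (k *: u + u') = k *: tens_mul t u + tens_mul t u'.
Proof.
rewrite tens_mul.unlock; apply: tens_lift_linearl => a b.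
exact: (tens_lift_linear (tens_mul_inner a b)).
Qed.

Fact tens_mulDr : right_distributive tens_mul +%R.
Proof.
by move=> t u u'; have := tens_mul_linearr 1 t u u'; rewrite !scale1r.
Qed.

Fact tens_mul0l u : tens_mul 0 u = 0.
Proof. by have := tens_mulDl 0 0 u; rewrite addr0 -[LHS]addr0 => /addrI <-. Qed.

Fact tens_mul0r t : tens_mul t 0 = 0.
Proof. by have := tens_mulDr t 0 0; rewrite addr0 -[LHS]addr0 => /addrI <-. Qed.

Fact tens_mulZl (k : K) (t u : T) : tens_mul (k *: t) u = k *: tens_mul t u.
Proof. by rewrite tens_mul.unlock; apply/tens_liftZ/tens_mul_outer. Qed.

Fact tens_mulZr (k : K) (t u : T) : tens_mul t (k *: u) = k *: tens_mul t u.
Proof. by rewrite -[k *: u]addr0 tens_mul_linearr tens_mul0r addr0. Qed.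

Fact tens_mulA : associative tens_mul.
Proof.
move=> t u v; elim/tens_ind: t => [|t t' IH IH'|a b].
- by rewrite (tens_mul0l u) (tens_mul0l v) (tens_mul0l (tens_mul u v)).
- rewrite (tens_mulDl t t' (tens_mul u v)) (tens_mulDl t t' u).
  by rewrite (tens_mulDl (tens_mul t u) (tens_mul t' u) v) IH IH'.
elim/tens_ind: u => [|u u' IH IH'|c d].
- by rewrite (tens_mul0l v) (tens_mul0r (a ⊗ b)) (tens_mul0l v).
- rewrite (tens_mulDl u u' v) (tens_mulDr (a ⊗ b) u u').
  rewrite (tens_mulDr (a ⊗ b) (tens_mul u v) (tens_mul u' v)).
  by rewrite (tens_mulDl (tens_mul (a ⊗ b) u) (tens_mul (a ⊗ b) u') v) IH IH'.
elim/tens_ind: v => [|v v' IH IH'|c' d'].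
- by rewrite (tens_mul0r (c ⊗ d)) (tens_mul0r (a ⊗ b)) tens_mul0r.
- rewrite (tens_mulDr (c ⊗ d) v v') tens_mulDr.
  by rewrite (tens_mulDr (tens_mul (a ⊗ b) (c ⊗ d)) v v') IH IH'.
by rewrite !tens_mulE !mulrA.
Qed.

Fact tens_mul1 : left_id (1 ⊗ 1) tens_mul.
Proof.
elim/tens_ind => [|t u IH IH'|a b]; first by rewrite tens_mul0r.
  by rewrite tens_mulDr IH IH'.
by rewrite tens_mulE !mul1r.
Qed.

Fact tens_mulr1 : right_id (1 ⊗ 1) tens_mul.
Proof.
elim/tens_ind => [|t u IH IH'|a b]; first by rewrite tens_mul0l.
  by rewrite tens_mulDl IH IH'.
by rewrite tens_mulE !mulr1.
Qed.

Fact tens_1_neq0 : (1 ⊗ 1 : T) != 0.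
Proof.
have [phi [phil phi1]] := separating_functional (oner_neq0 A).
have [psi [psil psi1]] := separating_functional (oner_neq0 B).
pose f a b : K^o := phi a * psi b.
have bf : bilinear_map f.
  split=> [b|a] k x y; rewrite /f ?phil ?psil.
    by rewrite mulrDl -mulrA.
  by rewrite mulrDr mulrCA.
apply/eqP => T0; have := tens_liftE bf 1 1.
have := tens_lift_linear bf (-1) 0 0; rewrite T0 scaler0 addr0 scaleN1r addNr.
by move=> ->; rewrite /f phi1 psi1 mul1r => /esym/eqP; rewrite oner_eq0.
Qed.

HB.instance Definition _ := GRing.Zmodule_isNzRing.Build (tensor A B)
  tens_mulA tens_mul1 tens_mulr1 tens_mulDl tens_mulDr tens_1_neq0.

Fact tens_scaleAl (k : K) (t u : tensor A B) : k *: (t * u) = (k *: t) * u.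
Proof. exact/esym/tens_mulZl. Qed.

HB.instance Definition _ := GRing.Lmodule_isLalgebra.Build K (tensor A B)
  tens_scaleAl.

Fact tens_scaleAr (k : K) (t u : tensor A B) : k *: (t * u) = t * (k *: u).
Proof. exact/esym/tens_mulZr. Qed.

HB.instance Definition _ := GRing.Lalgebra_isAlgebra.Build K (tensor A B)
  tens_scaleAr.

Lemma tensM a b c d : (a ⊗ b : T) * (c ⊗ d) = (a * c) ⊗ (b * d).
Proof. exact: tens_mulE. Qed.

End TensorAlgebra.

Section HopfAlgebra.
Variable K : fieldType.

Definition tens_map (V V' W W' : lmodType K) (f : V -> V') (g : W -> W')
  : V ⊗ W -> V' ⊗ W' := tens_lift (fun v w => f v ⊗ g w).

Definition tens_assoc (V W X : lmodType K)
  : V ⊗ W ⊗ X -> V ⊗ (W ⊗ X) :=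
  tens_lift (fun t x => tens_lift (fun v w => v ⊗ (w ⊗ x)) t).

Record is_hopf_algebra (A : algType K) (Delta : {lrmorphism A -> (A ⊗ A)%type})
    (eps : {lrmorphism A -> K^o}) (S : {linear A -> A}) : Prop := IsHopfAlgebra {
  hopf_coassoc : forall x,
    tens_assoc (tens_map Delta idfun (Delta x)) = tens_map idfun Delta (Delta x);
  hopf_counitl : forall x, tens_lift (fun a b => (eps a : K) *: b) (Delta x) = x;
  hopf_counitr : forall x, tens_lift (fun a b => (eps b : K) *: a) (Delta x) = x;
  hopf_antipodel : forall x,
    tens_lift (fun a b => S a * b) (Delta x) = (eps x : K) *: 1;
  hopf_antipoder : forall x,
    tens_lift (fun a b => a * S b) (Delta x) = (eps x : K) *: 1
}.

End HopfAlgebra.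

(* The pairs (K, r, s) with K = Q(r,s), up to isomorphism: K has characteristic
   0 and no proper subfield containing r and s, and either r, s are
   algebraically independent over Q, or K embeds into a field of complex
   numbers, with r, s nonzero and r^2 <> s^2. *)
Section BaseField.
Variables (K : fieldType) (r s : K).

Definition generated_by_rs : Prop :=
  forall L : {pred K}, divring_closed L -> r \in L -> s \in L ->
  forall x, x \in L.

Definition indeterminates : Prop :=
  forall p : {poly {poly int}},
    (map_poly (map_poly intr) p).[s%:P].[r] = 0 -> p = 0.

Definition complex_parameters : Prop :=
  [/\ exists R : realType, inhabited {rmorphism K -> R[i]},
      r != 0, s != 0 & r ^+ 2 != s ^+ 2].

Definition base_field : Prop :=
  [/\ [pchar K] =i pred0, generated_by_rs & indeterminates \/ complex_parameters].

End BaseField.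

Inductive lie_type := TypeB | TypeC | TypeD.

Definition valid_rank (t : lie_type) (n : nat) : bool :=
  match t with TypeB | TypeC => (2 <= n)%N | TypeD => (4 <= n)%N end.

(* Indices start at 0: the nat i (or i : 'I_n) stands for i + 1 in the usual   *)
(* numbering 1, ..., n of the simple roots.  All the roots lie in the lattice  *)
(* Z^n spanned by the orthonormal basis eps_i of R^n.                          *)
Section RootSystem.
Variables (t : lie_type) (n : nat).

Definition epsv (i : nat) : 'rV[int]_n := \row_j (j == i :> nat)%:R.

Definition inner (u v : 'rV[int]_n) : int := \sum_j u 0 j * v 0 j.

Definition simple_root (i : nat) : 'rV[int]_n :=
  if (i.+1 < n)%N then epsv i - epsv i.+1 else
  match t with
  | TypeB => epsv i
  | TypeC => epsv i *+ 2
  | TypeD => epsv i.-1 + epsv i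
  end.

(* 2 (alpha_i, alpha_j) / (alpha_i, alpha_i), an exact division *)
Definition cartan (i j : nat) : int :=
  (inner (simple_root i) (simple_root j) *+ 2
     %/ inner (simple_root i) (simple_root i))%Z.

(* r_i = param_sub r i and s_i = param_sub s i *)
Definition param_sub (K : fieldType) (x : K) (i : nat) : K :=
  let l := inner (simple_root i) (simple_root i) in
  match t with TypeB => x ^ l | TypeC | TypeD => x ^ (l %/ 2)%Z end.

Variables (K : fieldType) (r s : K).

Definition structB (i j : nat) : K :=
  if (j.+1 < n)%N then
    r ^ (2 * inner (epsv j) (simple_root i))
    * s ^ (2 * inner (epsv j.+1) (simple_root i))
  else if (i.+1 < n)%N then r ^ (2 * inner (epsv j) (simple_root i))
  else r * s^-1.

Definition structC (i j : nat) : K :=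
  if (j.+1 < n)%N then
    r ^ inner (epsv j) (simple_root i) * s ^ inner (epsv j.+1) (simple_root i)
  else if (i.+1 < n)%N then r ^ (2 * inner (epsv j) (simple_root i))
  else r ^+ 2 * s ^- 2.

Definition structD (i j : nat) : K :=
  if (j.+1 < n)%N then
    r ^ inner (epsv j) (simple_root i) * s ^ inner (epsv j.+1) (simple_root i)
  else if i.+2 != n then
    r ^ inner (epsv j.-1) (simple_root i) * s ^ (- inner (epsv j) (simple_root i))
  else r^-1 * s^-1.

Definition struct_const (i j : nat) : K :=
  match t with
  | TypeB => structB i j | TypeC => structC i j | TypeD => structD i j
  end.

End RootSystem.

(* A noncommutative polynomial in letters x_i, i < n, listed as                *)
(* (coefficient, word) pairs.                                                  *)
Section SerreRelations.
Variables (K : fieldType) (n : nat).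

Definition word_poly := seq (K * seq 'I_n).

Definition word_value (A : algType K) (x : 'I_n -> A) (p : word_poly) : A :=
  \sum_(m <- p) m.1 *: \prod_(k <- m.2) x k.

Definition word_reverse (p : word_poly) : word_poly :=
  [seq (m.1, rev m.2) | m <- p].

(* x_i x_j - c x_j x_i *)
Definition serre1 (c : K) (i j : 'I_n) : word_poly :=
  [:: (1, [:: i; j]); (- c, [:: j; i])].

(* x_i^2 x_j - c1 x_i x_j x_i + c2 x_j x_i^2 *)
Definition serre2 (c1 c2 : K) (i j : 'I_n) : word_poly :=
  [:: (1, [:: i; i; j]); (- c1, [:: i; j; i]); (c2, [:: j; i; i])].

(* x_i^3 x_j - c1 x_i^2 x_j x_i + c2 x_i x_j x_i^2 - c3 x_j x_i^3 *)
Definition serre3 (c1 c2 c3 : K) (i j : 'I_n) : word_poly :=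
  [:: (1, [:: i; i; i; j]); (- c1, [:: i; i; j; i]); (c2, [:: i; j; i; i]);
      (- c3, [:: j; i; i; i])].

Variables (r s : K).

Inductive serreB : word_poly -> Prop :=
| serreB_far (i j : 'I_n) of (i.+1 < j)%N || (j.+1 < i)%N :
    serreB (serre1 1 i j)
| serreB_up (i j : 'I_n) of j = i.+1 :> nat :
    let ri := param_sub TypeB n r i in let si := param_sub TypeB n s i in
    serreB (serre2 (ri + si) (ri * si) i j)
| serreB_down (i j : 'I_n) of j = i.+1 :> nat & (j.+1 < n)%N :
    let rj := param_sub TypeB n r j in let sj := param_sub TypeB n s j in
    serreB (serre2 (rj^-1 + sj^-1) (rj^-1 * sj^-1) j i)
| serreB_last (i j : 'I_n) of j = i.+1 :> nat & j.+1 = n :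
    let c := r ^- 2 + r^-1 * s^-1 + s ^- 2 in
    serreB (serre3 c (r^-1 * s^-1 * c) (r ^- 3 * s ^- 3) j i).

Inductive serreC : word_poly -> Prop :=
| serreC_far (i j : 'I_n) of (i.+1 < j)%N || (j.+1 < i)%N :
    serreC (serre1 1 i j)
| serreC_up (i j : 'I_n) of j = i.+1 :> nat & (j.+1 < n)%N :
    serreC (serre2 (r + s) (r * s) i j)
| serreC_down (i j : 'I_n) of j = i.+1 :> nat & (j.+1 < n)%N :
    serreC (serre2 (r^-1 + s^-1) (r^-1 * s^-1) j i)
| serreC_last_up (i j : 'I_n) of j = i.+1 :> nat & j.+1 = n :
    let c := r ^+ 2 + r * s + s ^+ 2 in
    serreC (serre3 c (r * s * c) ((r * s) ^+ 3) i j)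
| serreC_last_down (i j : 'I_n) of j = i.+1 :> nat & j.+1 = n :
    serreC (serre2 (r ^- 2 + s ^- 2) (r ^- 2 * s ^- 2) j i).

Inductive serreD : word_poly -> Prop :=
| serreD_far (i j : 'I_n) of i != j & cartan TypeD n i j = 0
    & ~~ ((i.+2 == n) && (j.+1 == n)) & ~~ ((j.+2 == n) && (i.+1 == n)) :
    serreD (serre1 1 i j)
| serreD_fork (i j : 'I_n) of i.+2 = n & j.+1 = n :
    serreD (serre1 (r * s) i j)
| serreD_up (i j : 'I_n) of (i < j)%N & cartan TypeD n i j = -1 :
    serreD (serre2 (r + s) (r * s) i j)
| serreD_down (i j : 'I_n) of (i < j)%N & cartan TypeD n i j = -1 :
    serreD (serre2 (r^-1 + s^-1) (r^-1 * s^-1) j i).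

Definition serre (t : lie_type) : word_poly -> Prop :=
  match t with TypeB => serreB | TypeC => serreC | TypeD => serreD end.

End SerreRelations.

Section QuantumGroup.
Variables (K : fieldType) (r s : K) (t : lie_type) (n : nat).

Inductive gen : Type :=
| GenE of 'I_n | GenF of 'I_n
| GenW of 'I_n | GenWinv of 'I_n | GenW' of 'I_n | GenW'inv of 'I_n.

HB.instance Definition _ := gen_eqMixin gen.
HB.instance Definition _ := gen_choiceMixin gen.

Local Notation free := (free_alg K gen).
Local Notation e i := (free_var K (GenE i)).
Local Notation f i := (free_var K (GenF i)).
Local Notation w i := (free_var K (GenW i)).
Local Notation wV i := (free_var K (GenWinv i)).
Local Notation w' i := (free_var K (GenW' i)).
Local Notation w'V i := (free_var K (GenW'inv i)).
Local Notation p i j := (struct_const t n r s i j).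

Definition toral (g : gen) : bool :=
  match g with GenE _ | GenF _ => false | _ => true end.

Inductive quantum_eq : free -> free -> Prop :=
| rel_toral_comm g h of toral g & toral h :
    quantum_eq (free_var K g * free_var K h) (free_var K h * free_var K g)
| rel_w_inv i : quantum_eq (w i * wV i) 1
| rel_w'_inv i : quantum_eq (w' i * w'V i) 1
| rel_w_e i j : quantum_eq (w j * e i * wV j) (p i j *: e i)
| rel_w_f i j : quantum_eq (w j * f i * wV j) ((p i j)^-1 *: f i)
| rel_w'_e i j : quantum_eq (w' j * e i * w'V j) ((p j i)^-1 *: e i)
| rel_w'_f i j : quantum_eq (w' j * f i * w'V j) (p j i *: f i)
| rel_e_f i j :
    quantum_eq (e i * f j - f j * e i)
      ((i == j)%:R *:
         ((param_sub t n r i - param_sub t n s i)^-1 *: (w i - w' i)))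
| rel_e_serre q of serre r s t q :
    quantum_eq (word_value (fun k => e k) q) 0
| rel_f_serre q of serre r s t q :
    quantum_eq (word_value (fun k => f k) (word_reverse q)) 0.

Definition quantum_rel (z : free) : Prop :=
  exists x y, quantum_eq x y /\ z = x - y.

Definition gen_counit (g : gen) : K^o := (toral g)%:R.

Lemma word_value_counit (x : 'I_n -> gen) (q : word_poly K n) :
  (forall k, ~~ toral (x k)) -> all (fun m => m.2 != [::]) q ->
  free_eval gen_counit (word_value (fun k => free_var K (x k)) q) = 0.
Proof.
move=> nx /allP nq; rewrite /word_value linear_sum big_seq big1 // => m /nq.
rewrite linearZ /= rmorph_prod; case: m.2 => // k l _.
by rewrite big_cons /= free_eval_var /gen_counit (negPf (nx k)) mul0r scaler0.
Qed.

Lemma serre_nonempty (q : word_poly K n) : serre r s t q -> all (fun m => m.2 != [::]) q.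
Proof. by rewrite /serre; case: t => -[]. Qed.

Lemma quantum_proper : 1 \notin ideal quantum_rel.
Proof.
apply: (ideal_proper (f := free_eval gen_counit)) => _ [x [y [xy ->]]].
set phi := free_eval gen_counit.
have phi_var g : phi (free_var K g) = (toral g)%:R by exact: free_eval_var.
have phiM u v : phi (u * v) = phi u * phi v by exact: rmorphM.
have phiB u v : phi (u - v) = phi u - phi v by exact: linearB.
have phiZ (c : K) u : phi (c *: u) = c *: phi u by exact: linearZ.
have phi1 : phi 1 = 1 by exact: rmorph1.
have phi0 : phi 0 = 0 by exact: linear0.
transitivity (phi x - phi y); first exact: phiB.
apply/eqP; rewrite subr_eq0; apply/eqP.
case: xy => {x y} [g h gT hT|i|i|i j|i j|i j|i j|i j|q sq|q sq].
- by rewrite !phiM !phi_var gT hT.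
- by rewrite phiM phi1 !phi_var mulr1.
- by rewrite phiM phi1 !phi_var mulr1.
- by rewrite !phiM phiZ !phi_var mulr0 mul0r scaler0.
- by rewrite !phiM phiZ !phi_var mulr0 mul0r scaler0.
- by rewrite !phiM phiZ !phi_var mulr0 mul0r scaler0.
- by rewrite !phiM phiZ !phi_var mulr0 mul0r scaler0.
- by rewrite phiB !phiM !phiZ phiB !phi_var /= mulr0 !subrr !scaler0.
- by rewrite phi0 [LHS]word_value_counit // serre_nonempty.
- rewrite phi0 [LHS]word_value_counit // all_map.
  apply: sub_all (serre_nonempty sq) => m /=.
  by rewrite -!size_eq0 size_rev.
Qed.

Definition quantum_group := alg_quot quantum_proper.

HB.instance Definition _ := GRing.Algebra.on quantum_group.

Definition qgen (g : gen) : quantum_group := alg_pi quantum_proper (free_var K g).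

End QuantumGroup.

(* Main.v *)
From HB Require Import structures.
Require Import Defs.
From mathcomp Require Import all_boot all_order all_algebra.
From mathcomp Require Import monalg.
From mathcomp Require Import zify ring.

Set Implicit Arguments.
Unset Strict Implicit.
Unset Printing Implicit Defensive.

Import GRing.Theory.
Local Open Scope ring_scope.

(** A morphism out of an algebra given by generators and relations is a family
of elements of the target that satisfies the relations.  So [Delta], [eps] and
[S] exist as soon as the prescribed images of the generators form a
[quantum_family] in A ⊗ A, in K and in the converse algebra A^c respectively;
then [S], read back in A, is an anti-morphism.  The relations between toral
elements, the conjugation relations and the commutator [e_i, f_j] are checked
directly; the Serre relations are the only ones that need an idea.

Write L_c(y) = x y - c y x.  Every Serre polynomial in x = x_i, y = x_j is an
iterated skew commutator L_(a^m d) ... L_(a d) L_d (y) with a = p_ii and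
d = p_ji, and its length m + 1 is tied to b = p_ij by a^m d b = 1
([qserre_serre]).  The operators L_c commute with each other, so the order of
the coefficients may be chosen to suit the argument.

- For [Delta], put x + u and y + v in place of x and y, where x, y stand for
  e_i ⊗ 1, e_j ⊗ 1 and u, v for w_i ⊗ e_i, w_j ⊗ e_j.  Applied to y with d
  first, u disappears from every bracket; applied to v with a^m d first, x
  disappears from every bracket, because a^m d b = 1.  There are no mixed terms
  ([qad_add]): the image of the Serre polynomial is the sum of its values at x
  and at u, both of which vanish.
- For [S], write S(e_k) = v_k e_k with v_k = - w_k^-1.  Moving the v_k to the
  left turns the iterated skew commutator of the converse algebra, bracket by
  bracket, into a toral factor times a multiple of the one of A, with the
  coefficients in the opposite order ([qad_converse_twist]).
- The relations for the f_k are those for the e_k in a converse algebra, so the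
  same lemmas apply to A^c and (A ⊗ A)^c.

Coassociativity and the counit laws compare two algebra morphisms, so it
suffices to look at generators.  The antipode laws are not of this form; they
pass from u to (generator) * u by [antipodel_mul] and [antipoder_mul]. *)

(** * The converse algebra *)

Section ConverseAlgebra.
Variables (K : fieldType) (A : algType K).

HB.instance Definition _ := GRing.Lmodule.on A^c.

(* [A^c] unfolds to [A], so a bare product in the two facts below would be
   elaborated as the product of [A]; naming it pins the converse one. *)
Let cmul (x y : A^c) : A^c := x * y.

Fact converse_scaleAl (c : K) (x y : A^c) : c *: cmul x y = cmul (c *: x) y.
Proof. exact: (@scalerAr K A c y x). Qed.

HB.instance Definition _ :=
  GRing.Lmodule_isLalgebra.Build K A^c converse_scaleAl.

Fact converse_scaleAr (c : K) (x y : A^c) : c *: cmul x y = cmul x (c *: y).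
Proof. exact: (@scalerAl K A c y x). Qed.

HB.instance Definition _ :=
  GRing.Lalgebra_isAlgebra.Build K A^c converse_scaleAr.

End ConverseAlgebra.

Lemma converse_lrmorphism (K : fieldType) (A B : algType K)
    (f : {lrmorphism A -> B}) :
  exists phi : {lrmorphism A^c -> B^c}, forall a, phi a = f a.
Proof.
pose phi (a : A^c) : B^c := f a.
have phi_lin : linear phi by move=> c x y; exact: (linearP f c x y).
have phi_mul : monoid_morphism phi.
  split=> [|x y]; first exact: (rmorph1 f).
  exact: (rmorphM f y x).
pose m1 := GRing.isLinear.Build K _ _ _ phi phi_lin.
pose m2 := GRing.isMonoidMorphism.Build _ _ phi phi_mul.
pose F : {lrmorphism A^c -> B^c} := HB.pack phi m1 m2.
by exists F.
Qed.

Lemma lrmorphism_converse_linear (K : fieldType) (A : algType K)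
    (phi : {lrmorphism A -> A^c}) :
  exists S : {linear A -> A}, forall x, S x = phi x.
Proof.
pose S (x : A) : A := phi x.
have S_lin : linear S by move=> c x y; exact: (linearP phi c x y).
pose m := GRing.isLinear.Build K A A _ S S_lin.
pose F : {linear A -> A} := HB.pack S m.
by exists F.
Qed.

(** * Word polynomials *)

Section WordValue.
Variables (K : fieldType) (n : nat).
Implicit Types (A B : algType K) (q : word_poly K n).

Lemma word_value_converse A (x : 'I_n -> A) q :
  word_value (A := A^c) x q = word_value (A := A) x (word_reverse q).
Proof.
rewrite /word_value /word_reverse big_map; apply: eq_bigr => m _ /=.
by congr (_ *: _); rewrite rev_prodr.
Qed.

Lemma eq_word_value A (x y : 'I_n -> A) q :
  x =1 y -> word_value x q = word_value y q.
Proof. by move=> xy; apply: eq_bigr => m _; congr (_ *: _); apply: eq_bigr. Qed.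

Lemma rmorph_word_value A B (f : {lrmorphism A -> B}) (x : 'I_n -> A) q :
  f (word_value x q) = word_value (fun k => f (x k)) q.
Proof.
rewrite /word_value linear_sum; apply: eq_bigr => m _.
by rewrite linearZ /= rmorph_prod.
Qed.

End WordValue.

(** * Skew commutators *)

Section SkewCommutator.
Variables (K : fieldType) (A : algType K).
Implicit Types (a b c d : K) (x y z u v w : A).

Definition qcommute c x y := x * y = c *: (y * x).

Lemma qcommute_comm x y : GRing.comm x y -> qcommute 1 x y.
Proof. by rewrite /qcommute scale1r. Qed.

Lemma qcommute_sym c x y : c != 0 -> qcommute c x y -> qcommute c^-1 y x.
Proof. by rewrite /qcommute => c0 ->; rewrite scalerA mulVf // scale1r. Qed.

Lemma qcommute_inv c u v w :
  u * w = 1 -> w * u = 1 -> qcommute c u v -> qcommute c v w.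
Proof.
rewrite /qcommute => uw wu uv; rewrite -[LHS]mul1r -wu -mulrA [u * _]mulrA uv.
by rewrite -scalerAl -mulrA uw mulr1 scalerAr.
Qed.

Lemma qcommuteMr c d x y z :
  qcommute c x y -> qcommute d x z -> qcommute (c * d) x (y * z).
Proof.
rewrite /qcommute => xy xz.
by rewrite mulrA xy -scalerAl -[y * x * z]mulrA xz -scalerAr scalerA mulrA.
Qed.

Lemma qcommuteMl c d x y z :
  qcommute c x z -> qcommute d y z -> qcommute (c * d) (x * y) z.
Proof.
rewrite /qcommute => xz yz; rewrite -[x * y * z]mulrA yz -scalerAr.
by rewrite [x * (z * y)]mulrA xz -scalerAl scalerA mulrA [c * d]mulrC.
Qed.

Lemma qcommuteZr c d x y : qcommute c x y -> qcommute c x (d *: y).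
Proof.
by rewrite /qcommute -scalerAr -scalerAl => ->; rewrite !scalerA mulrC.
Qed.

Lemma qcommuteZl c d x y : qcommute c x y -> qcommute c (d *: x) y.
Proof.
by rewrite /qcommute -scalerAr -scalerAl => ->; rewrite !scalerA mulrC.
Qed.

Lemma qcommuteDr c x y z :
  qcommute c x y -> qcommute c x z -> qcommute c x (y + z).
Proof. by rewrite /qcommute mulrDr mulrDl scalerDr => -> ->. Qed.

Lemma qcommuteBr c x y z :
  qcommute c x y -> qcommute c x z -> qcommute c x (y - z).
Proof. by rewrite /qcommute mulrBr mulrBl scalerBr => -> ->. Qed.

Lemma qcommuteBl c x y z :
  qcommute c x z -> qcommute c y z -> qcommute c (x - y) z.
Proof. by rewrite /qcommute mulrBr mulrBl scalerBr => -> ->. Qed.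

Definition qcomm c x y : A := x * y - c *: (y * x).

Lemma qcommute_qcommr a b c u x y :
  qcommute a u x -> qcommute b u y -> qcommute (a * b) u (qcomm c x y).
Proof.
move=> ux uy; apply: qcommuteBr; first exact: qcommuteMr.
by apply: qcommuteZr; rewrite mulrC; apply: qcommuteMr.
Qed.

Lemma qcommute_qcomml a b c u x y :
  qcommute a x u -> qcommute b y u -> qcommute (a * b) (qcomm c x y) u.
Proof.
move=> xu yu; apply: qcommuteBl; first exact: qcommuteMl.
by apply: qcommuteZl; rewrite mulrC; apply: qcommuteMl.
Qed.

(** Left and right multiplications by [x] commute with each other, hence so do
their linear combinations [qcomm c x]. *)
Lemma qcomm_swap c d x y : qcomm c x (qcomm d x y) = qcomm d x (qcomm c x y).
Proof.
rewrite /qcomm !mulrBr !mulrBl !scalerBr -!scalerAl -!scalerAr !scalerA !mulrA.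
rewrite [d * c]mulrC !opprB addrACA [RHS]addrACA.
by congr (_ + _); rewrite addrC.
Qed.

Lemma qcommZ c d x y : qcomm c x (d *: y) = d *: qcomm c x y.
Proof.
by rewrite /qcomm scalerBr -scalerAr -scalerAl !scalerA [c * d]mulrC.
Qed.

(** The quantum analogue of ad(x)^m (y): the coefficients of the successive
brackets are d, a d, ..., a^(m-1) d. *)
Fixpoint qad a d m x y : A :=
  if m is m'.+1 then qad a (a * d) m' x (qcomm d x y) else y.

(** Since the brackets commute, the one with the largest power of [a] may as
well be applied first. *)
Lemma qad_last a d m x y :
  qad a d m.+1 x y = qad a d m x (qcomm (a ^+ m * d) x y).
Proof.
elim: m d y => [|m IH] d y; first by rewrite /= expr0 mul1r.
rewrite -[LHS]/(qad a (a * d) m.+1 x (qcomm d x y)) IH /= exprSr mulrA.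
by rewrite qcomm_swap.
Qed.

Lemma qad_rev a d m x y :
  a != 0 -> qad a^-1 (a ^+ m * d) m.+1 x y = qad a d m.+1 x y.
Proof.
move=> a0; elim: m y => [|m IH] y; first by rewrite expr0 mul1r.
rewrite -[LHS]/(qad a^-1 (a^-1 * (a ^+ m.+1 * d)) m.+1 x
                  (qcomm (a ^+ m.+1 * d) x y)).
by rewrite [RHS]qad_last -IH exprS -!mulrA mulKf.
Qed.

Lemma qadZ a d m c x y : qad a d m x (c *: y) = c *: qad a d m x y.
Proof. by elim: m d y => //= m IH d y; rewrite qcommZ IH. Qed.

Lemma qadD a d m x y z : qad a d m x (y + z) = qad a d m x y + qad a d m x z.
Proof.
elim: m d y z => //= m IH d y z; rewrite -IH; congr qad.
by rewrite /qcomm mulrDr mulrDl scalerDr opprD addrACA.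
Qed.

(** With the coefficients in the order d, a d, ..., the bracket of [u] with
each successive value is zero: u skew-commutes with the k-th one with
coefficient a^k d. *)
Lemma qad_absorbl a d m x u y : qcommute a u x -> qcommute d u y ->
  qad a d m (x + u) y = qad a d m x y.
Proof.
move=> ux; elim: m d y => //= m IH d y uy.
have -> : qcomm d (x + u) y = qcomm d x y.
  by rewrite /qcomm mulrDl mulrDr uy scalerDr opprD addrACA subrr addr0.
exact/IH/qcommute_qcommr.
Qed.

(** With the coefficients in the order a^m d, ..., a d, d, the k-th value
skew-commutes with [x] with coefficient a^k b, and is bracketed with [x] with
coefficient a^(m-k) d, which is the inverse; so [x] contributes nothing. *)
Lemma qad_absorbr a d b m x u y : qcommute a u x -> qcommute b y x ->
  a ^+ m * d * b = 1 -> qad a d m.+1 (x + u) y = qad a d m.+1 u y.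
Proof.
have step c b' z :
    qcommute b' z x -> c * b' = 1 -> qcomm c (x + u) z = qcomm c u z.
  move=> zx cb; rewrite /qcomm mulrDl mulrDr zx scalerDr scalerA cb scale1r.
  by rewrite opprD addrACA subrr add0r.
move=> ux; elim: m b y => [|m IH] b y yx adb; rewrite qad_last [RHS]qad_last.
  by rewrite (step _ _ _ yx).
rewrite (step _ _ _ yx) //; apply: (IH (a * b)); first exact: qcommute_qcomml.
by rewrite -adb exprSr; ring.
Qed.

(** The quantum binomial coefficients that the expansion would produce are all
zero, thanks to the relation between [a], [b], [d] and [m]. *)
Lemma qad_add a d b m x u y v :
    qcommute a u x -> qcommute d u y -> qcommute b v x ->
    a ^+ m * d * b = 1 ->
  qad a d m.+1 (x + u) (y + v) = qad a d m.+1 x y + qad a d m.+1 u v.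
Proof.
move=> ux uy vx adb.
by rewrite qadD (qad_absorbl _ ux uy) (qad_absorbr ux vx adb).
Qed.

Lemma qad_mul_comm a d m v x w y :
  GRing.comm v x -> GRing.comm v y -> GRing.comm v w -> GRing.comm w x ->
  qad a d m (v * x) (w * y) = v ^+ m * w * qad a d m x y.
Proof.
move=> vx vy vw wx; elim: m d w y vy vw wx => [|m IH] d w y vy vw wx.
  by rewrite expr0 mul1r.
have -> : qad a d m.+1 (v * x) (w * y)
          = qad a (a * d) m (v * x) (v * w * qcomm d x y).
  rewrite /=; congr qad; rewrite /qcomm mulrBr -scalerAr; congr (_ - _ *: _).
    by rewrite -!mulrA; congr (_ * _); rewrite !mulrA wx.
  by rewrite vw -!mulrA; congr (_ * _); rewrite !mulrA vy.
rewrite IH ?exprSr ?mulrA //.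
- have := qcommute_qcommr d (qcommute_comm vx) (qcommute_comm vy).
  by rewrite /qcommute mulr1 scale1r.
- exact: commrM.
- by rewrite /GRing.comm -mulrA wx !mulrA vx.
Qed.

Lemma qad1E a d x y : qad a d 1 x y = x * y - d *: (y * x).
Proof. by []. Qed.

Lemma qad2E a d x y :
  qad a d 2 x y =
    x * x * y - ((1 + a) * d) *: (x * y * x) + (a * d ^+ 2) *: (y * x * x).
Proof.
rewrite qad_last qad1E /qcomm mulrBr mulrBl scalerBr.
rewrite -scalerAr -scalerAl !scalerA !mulrA expr1 !opprB !addrA.
rewrite (ACl (1*(2*4)*3)) /= -opprD -scalerDl.
by congr (_ - _ *: _ + _ *: _); ring.
Qed.

Lemma qad3E a d x y :
  let c := (1 + a + a ^+ 2) * d in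
  qad a d 3 x y =
    x * x * x * y - c *: (x * x * y * x) + (a * d * c) *: (x * y * x * x)
      - (a * d) ^+ 3 *: (y * x * x * x).
Proof.
rewrite qad_last.
have -> z : qad a d 2 x (qcomm (a ^+ 2 * d) x z)
            = qcomm (a ^+ 2 * d) x (qad a d 2 x z).
  by rewrite /= !(qcomm_swap (a ^+ 2 * d)).
rewrite qad2E {1}/qcomm.
rewrite !(mulrBr, mulrDr, mulrBl, mulrDl) !(scalerBr, scalerDr).
rewrite -!scalerAr -!scalerAl !scalerA !mulrA !opprD !opprK !addrA.
rewrite (ACl (1*(2*4)*(3*5)*6)) /= -opprD -!scalerDl.
by congr (_ - _ *: _ + _ *: _ - _ *: _); ring.
Qed.

End SkewCommutator.

(** In the converse algebra, one bracket of [v * x] with [w * z] is a multiple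
of [v * w] times the bracket of [x] with [z] in [A] whose coefficient is
determined by the skew-commutation of the toral factors.  The hypothesis on
[g] says that this coefficient is [e] at the first step, if one starts with
a^m d; it is then multiplied by [a] at each step, so that the brackets of [A]
come in increasing order. *)
Lemma qad_converse_twist (K : fieldType) (A : algType K) (a d e g h : K) m
    (x y v w : A) :
    GRing.comm w v -> qcommute a x v -> qcommute g y v -> qcommute h x w ->
    g = a ^+ m * d * h * e ->
  exists c, qad (A := A^c) a d m.+1 (v * x) (w * y)
            = c *: (v ^+ m.+1 * w * qad a e m.+1 x y).
Proof.
have step c e' g' h' w' z :
    GRing.comm w' v -> qcommute g' z v -> qcommute h' x w' ->
    g' = c * h' * e' ->
  qcomm (A := A^c) c (v * x) (w' * z) = - (c * h') *: (v * w' * qcomm e' x z).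
  move=> wv zv xw ge.
  have E1 : w' * z * (v * x) = g' *: (v * w' * (z * x)).
    by rewrite mulrA -[w' * z * v]mulrA zv -scalerAr -scalerAl !mulrA wv.
  have E2 : v * x * (w' * z) = h' *: (v * w' * (x * z)).
    by rewrite mulrA -[v * x * w']mulrA xw -scalerAr -scalerAl !mulrA.
  rewrite -[LHS]/(w' * z * (v * x) - c *: (v * x * (w' * z))).
  rewrite E1 E2 /qcomm mulrBr -scalerAr scalerBr !scalerA ge.
  by rewrite !mulNr !scaleNr opprK addrC.
move=> wv xv; elim: m e g h w y wv => [|m IH] e g h w y wv yv xw ge.
  exists (- (a ^+ 0 * d * h)); rewrite expr1.
  by rewrite -(step _ _ _ _ _ _ wv yv xw ge) expr0 mul1r.
have [||||c Ec] := IH (a * e) (a * g) (a * h) (v * w) (qcomm e x y).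
- by rewrite /GRing.comm -mulrA wv.
- exact: qcommute_qcomml.
- exact: qcommuteMr.
- by rewrite ge exprSr; ring.
exists (- (a ^+ m.+1 * d * h) * c).
rewrite qad_last (step _ _ _ _ _ _ wv yv xw ge).
by rewrite qadZ Ec scalerA [v ^+ m.+2]exprSr !mulrA.
Qed.

(** * Serre polynomials as iterated skew commutators *)

Section SerreAsSkewCommutator.
Variables (K : fieldType) (n : nat).
Implicit Types (p : 'I_n -> 'I_n -> K) (q : word_poly K n).

(** The algebra is quantified over because the same polynomial is evaluated in
A, in A ⊗ A and in their converses. *)
Definition qserre p q : Prop := exists i j m,
  p i i ^+ m * p j i * p i j = 1 /\
  forall (A : algType K) (x : 'I_n -> A),
    word_value x q = qad (p i i) (p j i) m.+1 (x i) (x j).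

Lemma qserre1 p c i j :
  p j i = c -> p i j = c^-1 -> c != 0 -> qserre p (serre1 c i j).
Proof.
move=> pji pij c0; exists i, j, 0%N; split=> [|A x].
  by rewrite pij pji expr0 mul1r divff.
rewrite /word_value /serre1 !big_cons !big_nil /= ?big_cons ?big_nil /qcomm.
by rewrite pji !mulr1 addr0 scale1r scaleNr.
Qed.

Lemma qserre2 p c1 c2 i j : p i i * p j i * p i j = 1 ->
  (1 + p i i) * p j i = c1 -> p i i * p j i ^+ 2 = c2 ->
  qserre p (serre2 c1 c2 i j).
Proof.
move=> pe <- <-; exists i, j, 1%N; split=> // A x.
rewrite qad2E /word_value /serre2 !big_cons !big_nil /= ?big_cons ?big_nil.
by rewrite !mulr1 addr0 scale1r scaleNr addrA !mulrA.
Qed.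

Lemma qserre3 p c1 c2 c3 i j : p i i ^+ 2 * p j i * p i j = 1 ->
  (1 + p i i + p i i ^+ 2) * p j i = c1 -> p i i * p j i * c1 = c2 ->
  (p i i * p j i) ^+ 3 = c3 -> qserre p (serre3 c1 c2 c3 i j).
Proof.
move=> pe <- <- <-; exists i, j, 2%N; split=> // A x.
rewrite qad3E /word_value /serre3 !big_cons !big_nil /= ?big_cons ?big_nil.
by rewrite !mulr1 addr0 scale1r !scaleNr !addrA !mulrA.
Qed.

(** Passing to (p_ji)^-1 inverts a and, as a^m d b = 1, replaces d by a^m d:
the coefficients of the brackets are the same, in the opposite order.  The
f_k commute past the w'_k with these inverse constants. *)
Lemma qserre_dual p q : (forall i j, p i j != 0) ->
  qserre p q -> qserre (fun i j => (p j i)^-1) q.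
Proof.
move=> p0 [i [j [m [pe E]]]]; exists i, j, m; split=> [|A x].
  by rewrite exprVn -!invfM -[1]invr1 -pe; congr _^-1; ring.
rewrite E -qad_rev //; congr (qad _ _ _ _ _).
by apply: (mulIf (p0 i j)); rewrite pe mulVf.
Qed.

Section Transfer.
Variables (p : 'I_n -> 'I_n -> K) (q : word_poly K n).
Hypothesis pq : qserre p q.

Lemma qserre_add (A : algType K) (x u : 'I_n -> A) :
    (forall i j, qcommute (p j i) (u i) (x j)) ->
  word_value (fun k => x k + u k) q = word_value x q + word_value u q.
Proof.
by move=> ux; have [i [j [m [pe E]]]] := pq; rewrite !E (qad_add _ _ _ pe).
Qed.

Lemma qserre_mul_comm (A : algType K) (v x : 'I_n -> A) :
    (forall i j, GRing.comm (v i) (x j)) ->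
    (forall i j, GRing.comm (v i) (v j)) ->
  word_value x q = 0 -> word_value (fun k => v k * x k) q = 0.
Proof.
move=> vx vv; have [i [j [m [_ E]]]] := pq; rewrite !E qad_mul_comm // => ->.
by rewrite mulr0.
Qed.

Lemma qserre_converse_twist (A : algType K) (v x : 'I_n -> A) :
    (forall i j, GRing.comm (v i) (v j)) ->
    (forall i j, qcommute (p i j) (x i) (v j)) ->
  word_value x q = 0 -> word_value (A := A^c) (fun k => v k * x k) q = 0.
Proof.
move=> vv xv; have [i [j [m [pe E]]]] := pq; rewrite E => x0.
have [|c] := qad_converse_twist (m := m) (d := p j i) (e := p j i)
               (vv j i) (xv i i) (xv j i) (xv i j).
  by rewrite pe mul1r.
by rewrite x0 mulr0 scaler0 E => ->.
Qed.

End Transfer.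

End SerreAsSkewCommutator.

(** * The structure constants of types B, C and D *)

Lemma base_field_neq0 (K : fieldType) (r s : K) :
  base_field r s -> r != 0 /\ s != 0.
Proof.
case=> _ _ [ind|[_ r0 s0 _] //]; split; apply/eqP => z.
  have := ind 'X%:P.
  rewrite !map_polyC /= map_polyX !hornerC hornerX z => /(_ erefl)/eqP.
  by rewrite polyC_eq0 polyX_eq0.
have := ind 'X; rewrite !map_polyX !hornerX hornerC z => /(_ erefl)/eqP.
by rewrite polyX_eq0.
Qed.

Section RootPairings.
Variables (n : nat).

Lemma inner_epsvl k (v : 'rV[int]_n) (kn : (k < n)%N) :
  inner (epsv n k) v = v 0 (Ordinal kn).
Proof.
rewrite /inner (bigD1 (Ordinal kn)) //= mxE eqxx mul1r big1 ?addr0 // => j jk.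
by rewrite mxE -val_eqE /= in jk *; rewrite (negPf jk) mul0r.
Qed.

Lemma inner_epsv_root t k i : (k < n)%N -> (i < n)%N ->
  inner (epsv n k) (simple_root t n i) =
  if (i.+1 < n)%N then (k == i)%:R - (k == i.+1)%:R else
  match t with
  | TypeB => (k == i)%:R
  | TypeC => (k == i)%:R *+ 2
  | TypeD => (k == i.-1)%:R + (k == i)%:R
  end.
Proof.
move=> kn iN; rewrite inner_epsvl /simple_root.
by case: ifP => _; case: t; rewrite ?mulr2n !mxE.
Qed.

Lemma inner_rootl t i (v : 'rV[int]_n) :
  inner (simple_root t n i) v =
  if (i.+1 < n)%N then inner (epsv n i) v - inner (epsv n i.+1) v else
  match t with
  | TypeB => inner (epsv n i) v
  | TypeC => inner (epsv n i) v *+ 2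
  | TypeD => inner (epsv n i.-1) v + inner (epsv n i) v
  end.
Proof.
have innerD u w : inner (u + w) v = inner u v + inner w v.
  by rewrite /inner -big_split; apply: eq_bigr => j _; rewrite mxE mulrDl.
have innerN u : inner (- u) v = - inner u v.
  by rewrite /inner -sumrN; apply: eq_bigr => j _; rewrite mxE mulNr.
by rewrite /simple_root; case: ifP => _; case: t;
  rewrite ?mulr2n ?innerD ?innerN.
Qed.

End RootPairings.

Section StructureConstants.
Variables (K : fieldType) (r s : K) (n : nat).
Hypotheses (r0 : r != 0) (s0 : s != 0).
Implicit Types (i j : 'I_n) (x : K).

(* Replaces each test between indices by its truth value, when the hypotheses
   decide it; the pairings of roots then reduce by computation in int. *)
Ltac decide_indices :=
  repeat match goal with
  | |- context [(?a < ?b)%N] =>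
      first [ have -> : (a < b)%N = true by lia
            | have -> : (a < b)%N = false by lia ]
  | |- context [@eq_op _ ?a ?b] =>
      first [ have -> : (@eq_op _ a b) = true by lia
            | have -> : (@eq_op _ a b) = false by lia ]
  end.

Ltac eval_pairings := rewrite ?inner_epsv_root; try lia; decide_indices.

Ltac eval_struct :=
  rewrite /struct_const /structB /structC /structD; decide_indices;
  eval_pairings; rewrite /=;
  first [done | exact: mulr1 | exact: mul1r | exact: (mulr1 1)].

Lemma struct_const_neq0 t i j : struct_const t n r s i j != 0.
Proof.
by case: t; rewrite /struct_const /structB /structC /structD;
  repeat case: ifP => _;
  rewrite ?mulf_neq0 ?expfz_neq0 ?expf_neq0 ?invr_neq0 ?expf_neq0.
Qed.

Lemma struct_const_diag t i : valid_rank t n ->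
  struct_const t n r s i i = param_sub t n r i / param_sub t n s i.
Proof.
rewrite /valid_rank => hn; have iN := ltn_ord i; rewrite /param_sub !inner_rootl.
by case: t hn => hn; case: (ltnP i.+1 n) => lt_i; eval_pairings; eval_struct.
Qed.

Lemma param_subB_lt x i : (i.+1 < n)%N -> param_sub TypeB n x i = x ^+ 2.
Proof.
by move=> lt_i; rewrite /param_sub inner_rootl; decide_indices; eval_pairings.
Qed.

Lemma param_subB_last x i : i.+1 = n -> param_sub TypeB n x i = x.
Proof.
by move=> iN; rewrite /param_sub inner_rootl; decide_indices; eval_pairings.
Qed.

Lemma param_subC_lt x i : (i.+1 < n)%N -> param_sub TypeC n x i = x.
Proof.
by move=> lt_i; rewrite /param_sub inner_rootl; decide_indices; eval_pairings.
Qed.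

Lemma param_subC_last x i : i.+1 = n -> param_sub TypeC n x i = x ^+ 2.
Proof.
by move=> iN; rewrite /param_sub inner_rootl; decide_indices; eval_pairings.
Qed.

Lemma param_subD x i : (1 < n)%N -> param_sub TypeD n x i = x.
Proof.
move=> n1; have iN := ltn_ord i; rewrite /param_sub inner_rootl.
by case: (ltnP i.+1 n) => lt_i; eval_pairings.
Qed.

Lemma struct_const_farBC t i j :
  t <> TypeD -> (i.+1 < j)%N || (j.+1 < i)%N -> struct_const t n r s i j = 1.
Proof.
have := ltn_ord i; have := ltn_ord j => jN iN.
by case: t => // _ far;
  case: (ltnP j.+1 n) => lt_j; case: (ltnP i.+1 n) => lt_i; eval_struct.
Qed.

Lemma structB_up i j :
  j = i.+1 :> nat -> struct_const TypeB n r s i j = r ^- 2.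
Proof.
by move=> ji; have jn := ltn_ord j; case: (ltnP j.+1 n) => lt_j; eval_struct.
Qed.

Lemma structB_down i j :
  j = i.+1 :> nat -> struct_const TypeB n r s j i = s ^+ 2.
Proof.
by move=> ji; have jn := ltn_ord j; case: (ltnP j.+1 n) => lt_j; eval_struct.
Qed.

Lemma structC_up i j : j = i.+1 :> nat ->
  struct_const TypeC n r s i j = if (j.+1 < n)%N then r^-1 else r ^- 2.
Proof.
by move=> ji; have jn := ltn_ord j; case: (ltnP j.+1 n) => lt_j; eval_struct.
Qed.

Lemma structC_down i j : j = i.+1 :> nat ->
  struct_const TypeC n r s j i = if (j.+1 < n)%N then s else s ^+ 2.
Proof.
by move=> ji; have jn := ltn_ord j; case: (ltnP j.+1 n) => lt_j; eval_struct.
Qed.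

Lemma cartanD i j : (3 < n)%N ->
  cartan TypeD n i j = inner (simple_root TypeD n i) (simple_root TypeD n j).
Proof.
move=> n3; rewrite /cartan; have iN := ltn_ord i.
have -> : inner (simple_root TypeD n i) (simple_root TypeD n i) = 2.
  by rewrite inner_rootl; case: (ltnP i.+1 n) => lt_i; eval_pairings.
by rewrite -[inner _ _ *+ 2]mulr_natr mulzK.
Qed.

(** The edges of the Dynkin diagram of type D: the chain of the first n - 1
roots, and the branch that joins the last root to the one of index n - 3,
counting from 0. *)
Lemma cartanD_edge i j : (3 < n)%N -> (i < j)%N -> cartan TypeD n i j = -1 ->
  (j.+1 < n)%N /\ j = i.+1 :> nat \/ j.+1 = n /\ i.+3 = n.
Proof.
move=> n3; rewrite cartanD // inner_rootl => ij; have jN := ltn_ord j.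
rewrite ifT; last lia.
rewrite !inner_epsv_root; try lia.
case: (ltnP j.+1 n) => lt_j; last lia.
have -> : (i == j.+1 :> nat) = false by lia.
lia.
Qed.

Lemma structD_up i j : (3 < n)%N -> (i < j)%N -> cartan TypeD n i j = -1 ->
  struct_const TypeD n r s i j = r^-1.
Proof. by move=> n3 ij /(cartanD_edge n3 ij) [] [h1 h2]; eval_struct. Qed.

Lemma structD_down i j : (3 < n)%N -> (i < j)%N -> cartan TypeD n i j = -1 ->
  struct_const TypeD n r s j i = s.
Proof. by move=> n3 ij /(cartanD_edge n3 ij) [] [h1 h2]; eval_struct. Qed.

Lemma structD_fork_up i j : (3 < n)%N -> i.+2 = n -> j.+1 = n ->
  struct_const TypeD n r s i j = (r * s)^-1.
Proof. by move=> n3 iN jN; rewrite invfM; eval_struct. Qed.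

Lemma structD_fork_down i j : (3 < n)%N -> i.+2 = n -> j.+1 = n ->
  struct_const TypeD n r s j i = r * s.
Proof. by move=> n3 iN jN; eval_struct. Qed.

Lemma cartanD_far i j : (3 < n)%N -> i != j -> cartan TypeD n i j = 0 ->
    ~~ ((i.+2 == n) && (j.+1 == n)) -> ~~ ((j.+2 == n) && (i.+1 == n)) ->
  (i.+1 < j)%N && ~~ ((i.+3 == n) && (j.+1 == n)) ||
  (j.+1 < i)%N && ~~ ((j.+3 == n) && (i.+1 == n)).
Proof.
move=> n3; rewrite cartanD // inner_rootl -val_eqE /= => ij.
have iN := ltn_ord i; have jN := ltn_ord j.
case: (ltnP i.+1 n) => lt_i; rewrite !inner_epsv_root; try lia.
  by case: (ltnP j.+1 n) => lt_j; lia.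
by case: (ltnP j.+1 n) => lt_j; lia.
Qed.

Lemma structD_far i j : (3 < n)%N ->
  (i.+1 < j)%N && ~~ ((i.+3 == n) && (j.+1 == n)) ||
  (j.+1 < i)%N && ~~ ((j.+3 == n) && (i.+1 == n)) ->
  struct_const TypeD n r s i j = 1.
Proof.
move=> n3; have iN := ltn_ord i; have jN := ltn_ord j.
by case/orP=> /andP [ij nf];
  case: (ltnP j.+1 n) => lt_j; case: (ltnP i.+1 n) => lt_i; eval_struct.
Qed.

(** With a = r_i / s_i and with b, d read off from the pairings of roots, one
has a^m d b = 1 for every Serre relation of the three types, and the
coefficients of the relation are those of the iterated skew commutator. *)
Lemma qserre_serre t (q : word_poly K n) :
  valid_rank t n -> serre r s t q -> qserre (struct_const t n r s) q.
Proof.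
move=> hn; have diag := fun i => struct_const_diag i hn.
case: t hn diag => hn diag; rewrite /serre.
- case=> [i j far|i j ji ri si|i j ji jn rj sj|i j ji jn c].
  + by apply: qserre1; rewrite ?invr1 ?oner_neq0 // struct_const_farBC // orbC.
  + have lt_i : (i.+1 < n)%N by rewrite -ji.
    by apply: qserre2; rewrite diag (structB_down ji) // ?(structB_up ji) //;
      rewrite /ri /si !param_subB_lt //; field; rewrite ?r0 ?s0.
  + by apply: qserre2; rewrite diag ?(structB_down ji) // (structB_up ji) //;
      rewrite /rj /sj !param_subB_lt //; field; rewrite ?r0 ?s0.
  + by apply: qserre3; rewrite diag ?(structB_down ji) // (structB_up ji) //;
      rewrite /c !param_subB_last //; field; rewrite ?r0 ?s0.
- case=> [i j far|i j ji jn|i j ji jn|i j ji jn c|i j ji jn].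
  + by apply: qserre1; rewrite ?invr1 ?oner_neq0 // struct_const_farBC // orbC.
  + have lt_i : (i.+1 < n)%N by rewrite -ji ltnW.
    by apply: qserre2; rewrite diag (structC_down ji) // ?(structC_up ji) //;
      rewrite jn !param_subC_lt //; field; rewrite ?r0 ?s0.
  + by apply: qserre2; rewrite diag ?(structC_down ji) // (structC_up ji) //;
      rewrite jn !param_subC_lt //; field; rewrite ?r0 ?s0.
  + have lt_i : (i.+1 < n)%N by rewrite -ji ltn_ord.
    by apply: qserre3; rewrite diag (structC_down ji) // ?(structC_up ji) //;
      rewrite jn ltnn !param_subC_lt // /c; field; rewrite ?r0 ?s0.
  + by apply: qserre2; rewrite diag ?(structC_down ji) // (structC_up ji) //;
      rewrite jn ltnn !param_subC_last //; field; rewrite ?r0 ?s0.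
- have {}diag i : struct_const TypeD n r s i i = r / s.
    by rewrite -/(struct_const TypeD n r s i i) diag !param_subD // ltnW // ltnW.
  case=> [i j ij c nf nf'|i j iN jN|i j ij c|i j ij c].
  + have far := cartanD_far hn ij c nf nf'.
    by apply: qserre1; rewrite ?invr1 ?oner_neq0 // structD_far // orbC.
  + by apply: qserre1; rewrite ?mulf_neq0 // ?(structD_fork_down hn iN jN) //
      (structD_fork_up hn iN jN).
  + by apply: qserre2; rewrite diag (structD_down hn ij c) //
      ?(structD_up hn ij c) //; field; rewrite ?r0 ?s0.
  + by apply: qserre2; rewrite diag ?(structD_down hn ij c) //
      (structD_up hn ij c) //; field; rewrite ?r0 ?s0.
Qed.

End StructureConstants.

(** * Generators and relations *)

(** Stated as an induction principle that multiplies by one generator at a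
time: this is the form in which the antipode laws propagate. *)
Definition generated_by (K : fieldType) (A : algType K) (X : Type) (g : X -> A) :=
  forall P : A -> Prop, P 1 ->
    (forall c u v, P u -> P v -> P (c *: u + v)) ->
    (forall x u, P u -> P (g x * u)) -> forall u, P u.

Lemma generated_ext (K : fieldType) (A B : algType K) (X : Type) (g : X -> A) :
  generated_by g -> forall phi psi : {lrmorphism A -> B},
  (forall x, phi (g x) = psi (g x)) -> phi =1 psi.
Proof.
move=> gen phi psi e; apply: gen => [|c u v eu ev|x u eu].
- by rewrite !rmorph1.
- by rewrite !linearP /= eu ev.
- by rewrite !rmorphM /= eu e.
Qed.

Lemma free_generated (K : fieldType) (X : choiceType) :
  generated_by (@free_var K X).
Proof.
move=> P P1 Plin Pmul u.
have P0 : P 0 by rewrite -(addNr 1) -scaleN1r; apply: Plin.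
rewrite [u]monalgE; elim/big_ind: _ => // [v w Pv Pw|k _].
  by rewrite -[v]scale1r; apply: Plin.
set c := mcoeff _ _.
have -> : << c *g k >> = c *: (<< k >> : free_alg K X).
  by apply/malgP => h; rewrite mcoeffZ !mcoeffU mulrnAr mulr1.
rewrite -[_ *: _]addr0; apply: Plin => //; rewrite -[k]fmK.
elim: (k : seq X) => [|x l IH]; first by rewrite -fmoneE.
suff -> : (<< FMonom (x :: l) >> : free_alg K X)
          = free_var K x * << FMonom l >> by exact: Pmul.
rewrite free_var.unlock /GRing.mul /= free_mul.unlock [RHS]malgM_def fgmulUU.
by rewrite mulr1; congr << _ >>; rewrite fmuE [RHS]fmmulE.
Qed.

Lemma alg_quot_lift (K : fieldType) (A : algType K) (S : A -> Prop)
    (proper : 1 \notin ideal S) (B : algType K) (f : {lrmorphism A -> B}) :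
    (forall y, S y -> f y = 0) ->
  exists phi : {lrmorphism alg_quot proper -> B},
    forall x, phi (alg_pi proper x) = f x.
Proof.
move=> fS; pose phi (x : alg_quot proper) := f (alg_repr x).
have phiE x : phi (alg_pi proper x) = f x.
  apply/eqP; rewrite -subr_eq0 -linearB; apply/eqP; apply: (ideal_killed fS).
  by apply/(alg_piP proper); rewrite alg_reprK.
have phi_lin : linear phi.
  move=> c x y; rewrite -[x]alg_reprK -[y]alg_reprK -linearP !phiE.
  exact: linearP.
have phi_mul : monoid_morphism phi.
  split=> [|x y]; first by rewrite -(rmorph1 (alg_pi proper)) phiE rmorph1.
  by rewrite -[x]alg_reprK -[y]alg_reprK -rmorphM !phiE rmorphM.
pose m1 := GRing.isLinear.Build K _ B _ phi phi_lin.
pose m2 := GRing.isMonoidMorphism.Build _ B phi phi_mul.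
pose F : {lrmorphism alg_quot proper -> B} := HB.pack phi m1 m2.
by exists F.
Qed.

Section QuantumFamily.
Variables (K : fieldType) (r s : K) (t : lie_type) (n : nat).
Local Notation p i j := (struct_const t n r s i j).
Local Notation Q := (quantum_group r s t n).

(** The defining relations, with the conjugation relations u x u^-1 = c x
rewritten as u x = c x u: this form survives in tensor products and converses,
and does not mention the inverse. *)
Record quantum_family (B : algType K) (g : gen n -> B) : Prop := QuantumFamily {
  qf_toral x y : toral x -> toral y -> GRing.comm (g x) (g y);
  qf_wK i : g (GenW i) * g (GenWinv i) = 1;
  qf_w'K i : g (GenW' i) * g (GenW'inv i) = 1;
  qf_we (i j : 'I_n) : qcommute (p i j) (g (GenW j)) (g (GenE i));
  qf_wf (i j : 'I_n) : qcommute (p i j)^-1 (g (GenW j)) (g (GenF i));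
  qf_w'e (i j : 'I_n) : qcommute (p j i)^-1 (g (GenW' j)) (g (GenE i));
  qf_w'f (i j : 'I_n) : qcommute (p j i) (g (GenW' j)) (g (GenF i));
  qf_ef (i j : 'I_n) :
    g (GenE i) * g (GenF j) - g (GenF j) * g (GenE i) =
    (i == j)%:R *:
      ((param_sub t n r i - param_sub t n s i)^-1
         *: (g (GenW i) - g (GenW' i)));
  qf_e_serre q : serre r s t q -> word_value (fun k => g (GenE k)) q = 0;
  qf_f_serre q : serre r s t q ->
    word_value (fun k => g (GenF k)) (word_reverse q) = 0
}.

Lemma quantum_lift (B : algType K) (g : gen n -> B) : quantum_family g ->
  exists phi : {lrmorphism Q -> B}, forall x, phi (qgen r s t x) = g x.
Proof.
move=> qg; set f := free_eval g.
have fV x : f (free_var K x) = g x by exact: free_eval_var.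
have fM u v : f (u * v) = f u * f v by exact: rmorphM.
have fZ c u : f (c *: u) = c *: f u by exact: linearZ.
have fB u v : f (u - v) = f u - f v by exact: linearB.
have [|phi phiE] :=
    alg_quot_lift (quantum_proper r s t n) (f := free_eval g); last first.
  by exists phi => x; rewrite -(fV x); apply: phiE.
move=> _ [x [y [xy ->]]]; rewrite -[LHS]/(f (x - y)) fB.
apply/eqP; rewrite subr_eq0; apply/eqP.
have f1 : f 1 = 1 by exact: rmorph1.
have f0 : f 0 = 0 by exact: linear0.
have conj c u v w : u * w = 1 -> qcommute c u v -> u * v * w = c *: v.
  by move=> uw ->; rewrite -scalerAl -mulrA uw mulr1.
case: xy => {x y} [x y tx ty|i|i|i j|i j|i j|i j|i j|q sq|q sq].
- by rewrite !fM !fV; apply: qf_toral.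
- by rewrite fM !fV f1 qf_wK.
- by rewrite fM !fV f1 qf_w'K.
- by rewrite !fM fZ !fV; apply: conj; [exact: qf_wK | exact: qf_we].
- by rewrite !fM fZ !fV; apply: conj; [exact: qf_wK | exact: qf_wf].
- by rewrite !fM fZ !fV; apply: conj; [exact: qf_w'K | exact: qf_w'e].
- by rewrite !fM fZ !fV; apply: conj; [exact: qf_w'K | exact: qf_w'f].
- by rewrite !(fB, fM, fZ) !fV qf_ef.
- rewrite f0 -(qf_e_serre qg sq) [LHS]rmorph_word_value.
  by apply: eq_word_value => k; apply: free_eval_var.
- rewrite f0 -(qf_f_serre qg sq) [LHS]rmorph_word_value.
  by apply: eq_word_value => k; apply: free_eval_var.
Qed.

Lemma quantum_generated : generated_by (qgen r s t (n := n)).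
Proof.
move=> P P1 Plin Pmul u; rewrite -[u]alg_reprK.
move: (alg_repr u); apply: free_generated => [|c v w Pv Pw|x v Pv].
- by rewrite rmorph1.
- by rewrite linearP; apply: Plin.
- by rewrite rmorphM; apply: Pmul.
Qed.

Lemma alg_pi_quantum_eq x y : quantum_eq r s t x y ->
  alg_pi (quantum_proper r s t n) x = alg_pi (quantum_proper r s t n) y.
Proof.
move=> xy; apply/alg_piP/spanP/span_gen; exists 1, (x - y), 1.
by rewrite mul1r mulr1; split=> //; exists x, y.
Qed.

Lemma qgen_family : quantum_family (qgen r s t (n := n)).
Proof.
pose f := alg_pi (quantum_proper r s t n).
have fM u v : f (u * v) = f u * f v by exact: rmorphM.
have fZ c u : f (c *: u) = c *: f u by exact: linearZ.
have fB u v : f (u - v) = f u - f v by exact: linearB.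
have f1 : f 1 = 1 by exact: rmorph1.
have f0 : f 0 = 0 by exact: linear0.
have tor x y : toral x -> toral y ->
    GRing.comm (qgen r s t (n := n) x) (qgen r s t y).
  move=> tx ty; have := alg_pi_quantum_eq (rel_toral_comm r s t tx ty).
  by rewrite -!/f !fM.
have wK (i : 'I_n) : qgen r s t (GenW i) * qgen r s t (GenWinv i) = 1.
  by have := alg_pi_quantum_eq (rel_w_inv r s t i); rewrite -!/f fM f1.
have w'K (i : 'I_n) : qgen r s t (GenW' i) * qgen r s t (GenW'inv i) = 1.
  by have := alg_pi_quantum_eq (rel_w'_inv r s t i); rewrite -!/f fM f1.
have conj c (u v w : Q) :
    u * w = 1 -> GRing.comm u w -> u * v * w = c *: v -> qcommute c u v.
  by move=> uw cuw e; rewrite /qcommute scalerAl -e -!mulrA -cuw uw mulr1.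
split=> //.
- move=> i j; apply: (conj _ _ _ _ (wK j)); first exact: tor.
  by have := alg_pi_quantum_eq (rel_w_e r s t i j); rewrite -!/f !fM fZ.
- move=> i j; apply: (conj _ _ _ _ (wK j)); first exact: tor.
  by have := alg_pi_quantum_eq (rel_w_f r s t i j); rewrite -!/f !fM fZ.
- move=> i j; apply: (conj _ _ _ _ (w'K j)); first exact: tor.
  by have := alg_pi_quantum_eq (rel_w'_e r s t i j); rewrite -!/f !fM fZ.
- move=> i j; apply: (conj _ _ _ _ (w'K j)); first exact: tor.
  by have := alg_pi_quantum_eq (rel_w'_f r s t i j); rewrite -!/f !fM fZ.
- move=> i j; have := alg_pi_quantum_eq (rel_e_f r s t i j).
  by rewrite -!/f !(fB, fM, fZ).
- move=> q sq; have := alg_pi_quantum_eq (rel_e_serre sq).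
  by rewrite -!/f f0 [f _]rmorph_word_value.
- move=> q sq; have := alg_pi_quantum_eq (rel_f_serre sq).
  by rewrite -!/f f0 [f _]rmorph_word_value.
Qed.

End QuantumFamily.

(** * Algebra morphisms between tensor products *)

Section TensorLift.
Variables (K : fieldType) (V W U : lmodType K) (f : V -> W -> U).
Hypothesis bf : bilinear_map f.

Lemma tens_liftD t u : tens_lift f (t + u) = tens_lift f t + tens_lift f u.
Proof. by have := tens_lift_linear bf 1 t u; rewrite !scale1r. Qed.

Lemma tens_lift0 : tens_lift f 0 = 0.
Proof.
by have := tens_lift_linear bf (-1) 0 0; rewrite scaler0 addr0 scaleN1r addNr.
Qed.

End TensorLift.

Section TensorMorphisms.
Variable K : fieldType.
Implicit Types A B C : algType K.

Lemma qcommute_tens A B (c d : K) (x x' : A) (y y' : B) :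
  qcommute c x x' -> qcommute d y y' -> qcommute (c * d) (x ⊗ y) (x' ⊗ y').
Proof.
by rewrite /qcommute !tensM => -> ->; rewrite tensZl tensZr scalerA.
Qed.

Lemma tens_alg_lift A B C (f : A -> B -> C) : bilinear_map f -> f 1 1 = 1 ->
    (forall a b c d, f (a * c) (b * d) = f a b * f c d) ->
  exists phi : {lrmorphism (A ⊗ B)%type -> C}, forall u, phi u = tens_lift f u.
Proof.
move=> bf f1 fM; set phi := tens_lift f.
have phi_lin : linear phi by exact: tens_lift_linear.
have phi0 : phi 0 = 0 := tens_lift0 bf.
have phiD : forall u v, phi (u + v) = phi u + phi v := tens_liftD bf.
have phi_mul : monoid_morphism phi.
  split=> [|u v]; first by rewrite /phi -[1]/(1 ⊗ 1) tens_liftE.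
  elim/tens_ind: u => [|u u' IH IH'|a b]; first by rewrite mul0r phi0 mul0r.
    by rewrite mulrDl !phiD IH IH' mulrDl.
  elim/tens_ind: v => [|v v' IH IH'|c d]; first by rewrite mulr0 phi0 mulr0.
    by rewrite mulrDr !phiD IH IH' mulrDr.
  by rewrite tensM /phi !tens_liftE.
pose m1 := GRing.isLinear.Build K _ C _ phi phi_lin.
pose m2 := GRing.isMonoidMorphism.Build _ C phi phi_mul.
pose F : {lrmorphism (A ⊗ B)%type -> C} := HB.pack phi m1 m2.
by exists F.
Qed.

Lemma tens1l_lrmorphism A B :
  exists phi : {lrmorphism A -> (A ⊗ B)%type}, forall a, phi a = a ⊗ 1.
Proof.
pose phi (a : A) : (A ⊗ B)%type := a ⊗ 1.
have phi_lin : linear phi by move=> c x y; rewrite /phi tensDl tensZl.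
have phi_mul : monoid_morphism phi by split=> // x y; rewrite /phi tensM mulr1.
pose m1 := GRing.isLinear.Build K _ _ _ phi phi_lin.
pose m2 := GRing.isMonoidMorphism.Build _ _ phi phi_mul.
pose F : {lrmorphism A -> (A ⊗ B)%type} := HB.pack phi m1 m2.
by exists F.
Qed.

Lemma tens1r_lrmorphism A B :
  exists phi : {lrmorphism B -> (A ⊗ B)%type}, forall b, phi b = 1 ⊗ b.
Proof.
pose phi (b : B) : (A ⊗ B)%type := 1 ⊗ b.
have phi_lin : linear phi by move=> c x y; rewrite /phi tensDr tensZr.
have phi_mul : monoid_morphism phi by split=> // x y; rewrite /phi tensM mulr1.
pose m1 := GRing.isLinear.Build K _ _ _ phi phi_lin.
pose m2 := GRing.isMonoidMorphism.Build _ _ phi phi_mul.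
pose F : {lrmorphism B -> (A ⊗ B)%type} := HB.pack phi m1 m2.
by exists F.
Qed.

Lemma bilinear_tens (A A' B B' : algType K) (f : {linear A -> A'})
    (g : {linear B -> B'}) : bilinear_map (fun a b => f a ⊗ g b).
Proof.
by split=> [b|a] c x y; rewrite linearP /= ?tensDl ?tensZl ?tensDr ?tensZr.
Qed.

Lemma tens_map_lrmorphism (A A' B B' : algType K) (f : {lrmorphism A -> A'})
    (g : {lrmorphism B -> B'}) :
  exists phi : {lrmorphism (A ⊗ B)%type -> (A' ⊗ B')%type},
    forall u, phi u = tens_map f g u.
Proof.
apply: tens_alg_lift; first exact: bilinear_tens.
  by rewrite !rmorph1.
by move=> a b c d; rewrite !rmorphM /= tensM.
Qed.

Section Associator.
Variables A B C : algType K.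

Let inner_bil (c : C) : bilinear_map (fun (a : A) (b : B) => a ⊗ (b ⊗ c)).
Proof. by split=> [b|a] k x y; rewrite ?tensDl ?tensZl ?tensDr ?tensZr. Qed.

Let outer_bil : bilinear_map
  (fun (u : (A ⊗ B)%type) (c : C) => tens_lift (fun a b => a ⊗ (b ⊗ c)) u).
Proof.
split=> [c|u] k x y; first exact: tens_lift_linear.
by apply: tens_lift_linearl => a b; rewrite !tensDr !tensZr.
Qed.

Lemma tens_assocE (a : A) (b : B) (c : C) :
  tens_assoc (a ⊗ b ⊗ c) = a ⊗ (b ⊗ c).
Proof. by rewrite /tens_assoc !tens_liftE. Qed.

Lemma tens_assoc_lrmorphism :
  exists phi : {lrmorphism (A ⊗ B ⊗ C)%type -> (A ⊗ (B ⊗ C))%type},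
    forall u, phi u = tens_assoc u.
Proof.
apply: tens_alg_lift; first exact: outer_bil.
  by rewrite tens_liftE.
move=> t c u d.
have LD (k : C) := tens_liftD (inner_bil k).
have L0 (k : C) := tens_lift0 (inner_bil k).
elim/tens_ind: t => [|t t' IH IH'|a b]; first by rewrite mul0r !L0 mul0r.
  by rewrite mulrDl !LD IH IH' mulrDl.
elim/tens_ind: u => [|u u' IH IH'|a' b']; first by rewrite mulr0 !L0 mulr0.
  by rewrite mulrDr !LD IH IH' mulrDr.
by rewrite tensM !tens_liftE // !tensM.
Qed.

End Associator.

End TensorMorphisms.

(** * The images of the generators satisfy the relations *)

Section HopfStructureFamilies.
Variables (K : fieldType) (r s : K) (t : lie_type) (n : nat).
Hypotheses (r0 : r != 0) (s0 : s != 0) (hn : valid_rank t n).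
Variables (A : algType K) (g : gen n -> A).
Hypothesis qg : quantum_family r s t g.
Local Notation p i j := (struct_const t n r s i j).
Local Notation e i := (g (GenE i)).
Local Notation f i := (g (GenF i)).
Local Notation w i := (g (GenW i)).
Local Notation wV i := (g (GenWinv i)).
Local Notation w' i := (g (GenW' i)).
Local Notation w'V i := (g (GenW'inv i)).

Definition comult_gen (x : gen n) : (A ⊗ A)%type :=
  match x with
  | GenE i => e i ⊗ 1 + w i ⊗ e i
  | GenF i => 1 ⊗ f i + f i ⊗ w' i
  | x => g x ⊗ g x
  end.

Definition antipode_gen (x : gen n) : A^c :=
  match x with
  | GenE i => - (wV i * e i)
  | GenF i => - (f i * w'V i)
  | GenW i => wV i
  | GenWinv i => w i
  | GenW' i => w'V i
  | GenW'inv i => w' i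
  end.

Lemma comult_ef i j :
  comult_gen (GenE i) * comult_gen (GenF j)
    - comult_gen (GenF j) * comult_gen (GenE i) =
  (i == j)%:R *:
    ((param_sub t n r i - param_sub t n s i)^-1
       *: (comult_gen (GenW i) - comult_gen (GenW' i))).
Proof.
rewrite /= !mulrDl !mulrDr !tensM !mul1r !mulr1.
have -> : (w i * f j) ⊗ (e i * w' j) = (f j * w i) ⊗ (w' j * e i).
  by rewrite (qf_wf qg j i) tensZl -tensZr (qf_w'e qg i j).
set a1 := e i ⊗ f j; set a2 := (f j * w i) ⊗ _.
have -> (b b' d d' : (A ⊗ A)%type) :
    a1 + b + (b' + a2) - (a1 + d' + (d + a2)) = (b - d) + (b' - d').
  rewrite !opprD !addrA (ACl (1*5*(4*8)*(2*7)*(3*6))) /=.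
  by rewrite !subrr !add0r addrA.
have tBl (x y z : A) : x ⊗ z - y ⊗ z = (x - y) ⊗ z.
  by rewrite -scaleN1r -tensZl -tensDl scaleN1r.
have tBr (x y z : A) : z ⊗ x - z ⊗ y = z ⊗ (x - y).
  by rewrite -scaleN1r -tensZr -tensDr scaleN1r.
rewrite tBl tBr (qf_ef qg).
have [<-|_] := eqVneq i j; last first.
  by rewrite !scale0r -(scale0r 0) tensZl tensZr !scale0r addr0.
rewrite !scale1r tensZl tensZr -scalerDr; congr (_ *: _).
by rewrite -tBl -tBr addrC addrA subrK.
Qed.

Lemma comult_family : quantum_family r s t comult_gen.
Proof.
have tor := qf_toral qg.
have tor1 x y : toral x -> toral y -> qcommute 1 (g x) (g y).
  by move=> *; apply: qcommute_comm; apply: tor.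
have one (x : A) : qcommute 1 x 1 by apply/qcommute_comm/commr1.
have tensl c (x x' y y' : A) :
    qcommute c x x' -> qcommute 1 y y' -> qcommute c (x ⊗ y) (x' ⊗ y').
  by move=> xx yy; rewrite -[c]mulr1; apply: qcommute_tens.
have tensr c (x x' y y' : A) :
    qcommute 1 x x' -> qcommute c y y' -> qcommute c (x ⊗ y) (x' ⊗ y').
  by move=> xx yy; rewrite -[c]mul1r; apply: qcommute_tens.
have [phil philE] := tens1l_lrmorphism A A.
have [phir phirE] := tens1r_lrmorphism A A.
split.
- by case=> [i|i|i|i|i|i] [j|j|j|j|j|j] //= _ _;
    rewrite /GRing.comm !tensM; congr (_ ⊗ _); exact: tor.
- by move=> i; rewrite /= tensM (qf_wK qg).
- by move=> i; rewrite /= tensM (qf_w'K qg).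
- move=> i j; have ij := qf_we qg i j.
  by apply: qcommuteDr; [apply: tensl | apply: tensr => //; apply: tor1].
- move=> i j; have ij := qf_wf qg i j.
  by apply: qcommuteDr; [apply: tensr | apply: tensl => //; apply: tor1].
- move=> i j; have ij := qf_w'e qg i j.
  by apply: qcommuteDr; [apply: tensl | apply: tensr => //; apply: tor1].
- move=> i j; have ij := qf_w'f qg i j.
  by apply: qcommuteDr; [apply: tensr | apply: tensl => //; apply: tor1].
- exact: comult_ef.
- move=> q sq; rewrite -[LHS]/(word_value (fun k => e k ⊗ 1 + w k ⊗ e k) q).
  have pq := qserre_serre r0 s0 hn sq.
  rewrite (qserre_add pq) => [|i j]; last by apply: tensl (qf_we qg _ _) (one _).
  rewrite -(eq_word_value q (fun k => philE (e k))) -rmorph_word_value.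
  rewrite (qf_e_serre qg sq) linear0 add0r.
  have wE k : w k ⊗ e k = (w k ⊗ 1) * phir (e k).
    by rewrite phirE tensM mulr1 mul1r.
  rewrite (eq_word_value q wE); apply: (qserre_mul_comm pq) => [i j|i j|].
  + by rewrite phirE /GRing.comm !tensM !mulr1 !mul1r.
  + by rewrite /GRing.comm !tensM !mulr1 tor.
  + by rewrite -rmorph_word_value (qf_e_serre qg sq) linear0.
- move=> q sq; have pq := qserre_serre r0 s0 hn sq.
  rewrite -word_value_converse.
  have [psil psilE] := converse_lrmorphism phil.
  have [psir psirE] := converse_lrmorphism phir.
  (* In the converse of A ⊗ A it is 1 ⊗ f_k that plays the part of w_k ⊗ e_k,
     hence the order of the two summands. *)
  have fE k : comult_gen (GenF k)
              = ((1 ⊗ w' k) : (A ⊗ A)^c) * psil (f k) + psir (f k).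
    rewrite psilE philE psirE phirE.
    transitivity ((f k ⊗ 1) * (1 ⊗ w' k) + 1 ⊗ f k); last by [].
    by rewrite tensM mulr1 mul1r addrC.
  have f0 : word_value (A := A^c) (fun k => f k) q = 0.
    by rewrite word_value_converse (qf_f_serre qg sq).
  rewrite (eq_word_value (A := (A ⊗ A)^c) q fE).
  rewrite (qserre_add (A := (A ⊗ A)^c) pq) => [|i j].
    rewrite -rmorph_word_value f0 linear0 addr0.
    apply: (qserre_mul_comm (A := (A ⊗ A)^c) (v := fun k => 1 ⊗ w' k) pq)
      => [i j|i j|].
    + rewrite psilE philE; apply/esym.
      transitivity ((1 ⊗ w' i) * (f j ⊗ 1)); first by [].
      transitivity ((f j ⊗ 1) * (1 ⊗ w' i)); last by [].
      by rewrite !tensM !mulr1 !mul1r.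
    + apply/esym.
      transitivity (((1 : A) ⊗ w' i) * ((1 : A) ⊗ w' j)); first by [].
      transitivity (((1 : A) ⊗ w' j) * ((1 : A) ⊗ w' i)); last by [].
      by rewrite !tensM tor.
    + by rewrite -rmorph_word_value f0 linear0.
  rewrite psilE philE psirE phirE.
  set u : (A ⊗ A)%type := 1 ⊗ w' j; set v : (A ⊗ A)%type := f j ⊗ 1.
  set z : (A ⊗ A)%type := 1 ⊗ f i.
  transitivity ((v * u) * z); first by [].
  transitivity (p j i *: (z * (v * u))); last by [].
  by rewrite {}/u {}/v {}/z !tensM !mulr1 !mul1r (qf_w'f qg) tensZr.
Qed.

Lemma antipode_family : quantum_family r s t antipode_gen.
Proof.
have tor := qf_toral qg.
have tor1 x y : toral x -> toral y -> qcommute 1 (g x) (g y).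
  by move=> *; apply: qcommute_comm; apply: tor.
have wVK i : wV i * w i = 1 by rewrite -(qf_wK qg i) tor.
have w'VK i : w'V i * w' i = 1 by rewrite -(qf_w'K qg i) tor.
have p0 (i j : 'I_n) := struct_const_neq0 r0 s0 t i j.
have ewV (i j : 'I_n) : qcommute (p i j) (e i) (wV j).
  exact: qcommute_inv (qf_wK qg j) (wVK j) (qf_we qg i j).
have fwV (i j : 'I_n) : qcommute (p i j)^-1 (f i) (wV j).
  exact: qcommute_inv (qf_wK qg j) (wVK j) (qf_wf qg i j).
have ew'V (i j : 'I_n) : qcommute (p j i)^-1 (e i) (w'V j).
  exact: qcommute_inv (qf_w'K qg j) (w'VK j) (qf_w'e qg i j).
have fw'V (i j : 'I_n) : qcommute (p j i) (f i) (w'V j).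
  exact: qcommute_inv (qf_w'K qg j) (w'VK j) (qf_w'f qg i j).
have qN c (x y : A) : qcommute c x y -> qcommute c (- x) y.
  by rewrite -[- x]scaleN1r; apply: qcommuteZl.
split.
- by case=> [i|i|i|i|i|i] [j|j|j|j|j|j] //= _ _; apply: tor.
- by move=> i; exact: (qf_wK qg i).
- by move=> i; exact: (qf_w'K qg i).
- move=> i j; rewrite -[p i j]mul1r.
  have wVwV := tor1 (GenWinv i) (GenWinv j) isT isT.
  by have := qN _ _ _ (qcommuteMl wVwV (ewV i j)).
- move=> i j; rewrite -[(p i j)^-1]mulr1.
  have w'VwV := tor1 (GenW'inv i) (GenWinv j) isT isT.
  by have := qN _ _ _ (qcommuteMl (fwV i j) w'VwV).
- move=> i j; rewrite -[(p j i)^-1]mul1r.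
  have wVw'V := tor1 (GenWinv i) (GenW'inv j) isT isT.
  by have := qN _ _ _ (qcommuteMl wVw'V (ew'V i j)).
- move=> i j; rewrite -[p j i]mulr1.
  have w'Vw'V := tor1 (GenW'inv i) (GenW'inv j) isT isT.
  by have := qN _ _ _ (qcommuteMl (fw'V i j) w'Vw'V).
- move=> i j.
  transitivity ((f j * w'V j) * (wV i * e i) - (wV i * e i) * (f j * w'V j)).
    by rewrite -[f j * _ * _]mulrNN -[wV i * _ * _]mulrNN.
  (* Both products become wV_i (...) w'V_j, so that their difference is a
     conjugate of the commutator of e_i and f_j. *)
  have -> : (f j * w'V j) * (wV i * e i) = wV i * (f j * e i) * w'V j.
    transitivity (f j * wV i * (w'V j * e i)).
      by rewrite -!mulrA; congr (_ * _); rewrite !mulrA [w'V j * _]tor.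
    rewrite (fwV j i) -!mulrA (ew'V i j) -scalerAl -!scalerAr.
    by rewrite !mulrA.
  have -> : (wV i * e i) * (f j * w'V j) = wV i * (e i * f j) * w'V j.
    by rewrite !mulrA.
  rewrite -mulrBl -mulrBr -opprB (qf_ef qg).
  have [<-|_] := eqVneq i j; last by rewrite !scale0r oppr0 mulr0 mul0r.
  rewrite !scale1r mulrN mulNr -scalerAr -scalerAl -scalerN; congr (_ *: _).
  rewrite mulrBr mulrBl wVK mul1r opprB; congr (_ - _).
  by rewrite -mulrA (qf_w'K qg) mulr1.
- move=> q sq; have pq := qserre_serre r0 s0 hn sq.
  have eE k : antipode_gen (GenE k) = - wV k * e k by rewrite mulNr.
  rewrite (eq_word_value (A := A^c) q eE).
  apply: (qserre_converse_twist pq (v := fun k => - wV k)) => [i j|i j|].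
  + by rewrite /GRing.comm !mulrNN tor.
  + by rewrite -[- _]scaleN1r; apply: qcommuteZr.
  + exact: (qf_e_serre qg sq).
- move=> q sq; have pq := qserre_dual p0 (qserre_serre r0 s0 hn sq).
  rewrite -word_value_converse.
  have fE k : antipode_gen (GenF k) = (- w'V k : A^c) * (f k : A^c).
    exact: esym (mulrN (f k) (w'V k)).
  rewrite (eq_word_value (A := (A^c)^c) q fE).
  apply: (qserre_converse_twist (A := A^c) pq (v := fun k => - w'V k))
    => [i j|i j|].
  + apply/esym; transitivity ((- w'V i) * (- w'V j)); first by [].
    transitivity ((- w'V j) * (- w'V i)); last by [].
    by rewrite !mulrNN tor.
  + transitivity ((- w'V j) * f i); first by [].
    transitivity ((p j i)^-1 *: (f i * (- w'V j))); last by [].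
    by apply/qN/qcommute_sym.
  + by rewrite word_value_converse; apply: (qf_f_serre qg sq).
Qed.

End HopfStructureFamilies.

Lemma counit_family (K : fieldType) (r s : K) t n :
  quantum_family r s t (@gen_counit K n).
Proof.
have word0 (q : word_poly K n) (x : 'I_n -> gen n) :
    all (fun m => m.2 != [::]) q -> (forall k, ~~ toral (x k)) ->
  word_value (fun k => gen_counit K (x k)) q = 0.
  move=> nq nx; rewrite -(word_value_counit nx nq) rmorph_word_value.
  by apply: eq_word_value => k; apply/esym/free_eval_var.
split=> /=.
- by move=> x y _ _; apply: mulrC.
- by move=> i; apply: mulr1.
- by move=> i; apply: mulr1.
- by move=> i j; rewrite /qcommute mulr0 mul0r scaler0.
- by move=> i j; rewrite /qcommute mulr0 mul0r scaler0.
- by move=> i j; rewrite /qcommute mulr0 mul0r scaler0.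
- by move=> i j; rewrite /qcommute mulr0 mul0r scaler0.
- by move=> i j; rewrite /gen_counit /= mulr0 !subrr !scaler0.
- by move=> q /serre_nonempty nq; apply: word0.
- move=> q /serre_nonempty nq; apply: word0 => //.
  rewrite all_map; apply: sub_all nq => m /=.
  by rewrite -!size_eq0 size_rev.
Qed.

(** * The Hopf algebra axioms *)

Section AntipodeConvolution.
Variables (K : fieldType) (A : algType K) (S : {linear A -> A}).
Hypothesis SM : forall x y, S (x * y) = S y * S x.

Lemma bilinear_antipodel : bilinear_map (fun a b => S a * b).
Proof.
split=> [b|a] c x y; first by rewrite linearP mulrDl scalerAl.
by rewrite mulrDr scalerAr.
Qed.

Lemma bilinear_antipoder : bilinear_map (fun a b => a * S b).
Proof.
split=> [b|a] c x y; first by rewrite mulrDl scalerAl.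
by rewrite linearP mulrDr scalerAr.
Qed.

(** Write L for the map a ⊗ b |-> S(a) b.  As [S] reverses products,
L(u (a ⊗ b)) = S(a) L(u) b, and the scalar L(u) comes out. *)
Lemma antipodel_mul (c : K) (u v : (A ⊗ A)%type) :
  tens_lift (fun a b => S a * b) u = c *: 1 ->
  tens_lift (fun a b => S a * b) (u * v)
  = c *: tens_lift (fun a b => S a * b) v.
Proof.
set L := tens_lift _ => uc.
have L0 : L 0 = 0 := tens_lift0 bilinear_antipodel.
have LD : forall x y, L (x + y) = L x + L y := tens_liftD bilinear_antipodel.
have LE a b : L (a ⊗ b) = S a * b by exact: tens_liftE bilinear_antipodel _ _.
elim/tens_ind: v => [|v v' IH IH'|a b]; first by rewrite mulr0 L0 scaler0.
  by rewrite mulrDr !LD IH IH' scalerDr.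
have -> : L (u * (a ⊗ b)) = S a * L u * b.
  elim/tens_ind: {uc} u => [|u u' IH IH'|x y].
  - by rewrite mul0r L0 mulr0 mul0r.
  - by rewrite mulrDl !LD IH IH' mulrDr mulrDl.
  - by rewrite tensM !LE SM !mulrA.
by rewrite uc LE -scalerAr mulr1 -scalerAl.
Qed.

Lemma antipoder_mul (c : K) (u v : (A ⊗ A)%type) :
  tens_lift (fun a b => a * S b) v = c *: 1 ->
  tens_lift (fun a b => a * S b) (u * v)
  = c *: tens_lift (fun a b => a * S b) u.
Proof.
set L := tens_lift _ => vc.
have L0 : L 0 = 0 := tens_lift0 bilinear_antipoder.
have LD : forall x y, L (x + y) = L x + L y := tens_liftD bilinear_antipoder.
have LE a b : L (a ⊗ b) = a * S b by exact: tens_liftE bilinear_antipoder _ _.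
elim/tens_ind: u => [|u u' IH IH'|a b]; first by rewrite mul0r L0 scaler0.
  by rewrite mulrDl !LD IH IH' scalerDr.
have -> : L ((a ⊗ b) * v) = a * L v * S b.
  elim/tens_ind: {vc} v => [|v v' IH IH'|x y].
  - by rewrite mulr0 L0 mulr0 mul0r.
  - by rewrite mulrDr !LD IH IH' mulrDr mulrDl.
  - by rewrite tensM !LE SM !mulrA.
by rewrite vc LE -scalerAr mulr1 -scalerAl.
Qed.

End AntipodeConvolution.

Section HopfAxioms.
Variables (K : fieldType) (r s : K) (t : lie_type) (n : nat).
Variables (A : algType K) (g : gen n -> A).
Hypotheses (genA : generated_by g) (qg : quantum_family r s t g).
Variables (Delta : {lrmorphism A -> (A ⊗ A)%type}) (eps : {lrmorphism A -> K^o}).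
Variable S : {linear A -> A}.
Hypothesis DeltaE : forall x, Delta (g x) = comult_gen g x.
Hypothesis epsE : forall x, eps (g x) = gen_counit K x.
Hypothesis SE : forall x, S (g x) = antipode_gen g x.
Hypotheses (S1 : S 1 = 1) (SM : forall x y, S (x * y) = S y * S x).

Lemma comult_coassoc (x : A) :
  tens_assoc (tens_map Delta idfun (Delta x)) = tens_map idfun Delta (Delta x).
Proof.
have [alpha alphaE] := tens_assoc_lrmorphism A A A.
have [phi phiE] := tens_map_lrmorphism Delta (idfun : {lrmorphism A -> A}).
have [psi psiE] := tens_map_lrmorphism (idfun : {lrmorphism A -> A}) Delta.
rewrite -alphaE -phiE -psiE; move: x.
have phiT a b : phi (a ⊗ b) = Delta a ⊗ b.
  by rewrite phiE /tens_map tens_liftE //; exact: (bilinear_tens Delta idfun).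
have psiT a b : psi (a ⊗ b) = a ⊗ Delta b.
  by rewrite psiE /tens_map tens_liftE //; exact: (bilinear_tens idfun Delta).
have alphaT a b c : alpha (a ⊗ b ⊗ c) = a ⊗ (b ⊗ c).
  by rewrite alphaE tens_assocE.
have alphaD u v : alpha (u + v) = alpha u + alpha v by exact: linearD.
have phiD u v : phi (u + v) = phi u + phi v by exact: linearD.
have psiD u v : psi (u + v) = psi u + psi v by exact: linearD.
have D1 : Delta 1 = 1 ⊗ 1 by exact: rmorph1.
apply: (generated_ext genA (phi := alpha \o phi \o Delta) (psi := psi \o Delta)).
move=> x /=; rewrite DeltaE; case: x => i /=.
- rewrite phiD psiD alphaD !phiT !psiT D1 !DeltaE /=.
  by rewrite tensDl tensDr alphaD !alphaT addrA.
- rewrite phiD psiD alphaD !phiT !psiT D1 !DeltaE /=.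
  by rewrite tensDl tensDr alphaD !alphaT addrA.
- by rewrite phiT psiT !DeltaE /= alphaT.
- by rewrite phiT psiT !DeltaE /= alphaT.
- by rewrite phiT psiT !DeltaE /= alphaT.
- by rewrite phiT psiT !DeltaE /= alphaT.
Qed.

Let epsM a b : (eps (a * b) : K) = (eps a : K) * (eps b : K).
Proof. exact: rmorphM. Qed.

Let eps1 : (eps 1 : K) = 1.
Proof. exact: rmorph1. Qed.

Let epsP c a b : (eps (c *: a + b) : K) = c * (eps a : K) + (eps b : K).
Proof. exact: linearP. Qed.

Lemma comult_counitl (x : A) :
  tens_lift (fun a b => (eps a : K) *: b) (Delta x) = x.
Proof.
have bil : bilinear_map (fun a b : A => (eps a : K) *: b).
  split=> [b|a] c y z; first by rewrite epsP scalerDl scalerA.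
  by rewrite scalerDr !scalerA mulrC.
have [||phi phiE] := @tens_alg_lift _ _ _ _ _ bil.
- by rewrite eps1 scale1r.
- by move=> a b c d; rewrite epsM -scalerAr -scalerAl scalerA mulrC.
rewrite -phiE; move: x.
have phiT a b : phi (a ⊗ b) = (eps a : K) *: b by rewrite phiE tens_liftE.
have phiD u v : phi (u + v) = phi u + phi v by exact: linearD.
apply: (generated_ext genA (phi := phi \o Delta) (psi := idfun)) => x /=.
by rewrite DeltaE; case: x => i /=; rewrite ?phiD !phiT ?eps1 !epsE;
  rewrite /gen_counit /= ?scale1r ?scale0r ?add0r ?addr0.
Qed.

Lemma comult_counitr (x : A) :
  tens_lift (fun a b => (eps b : K) *: a) (Delta x) = x.
Proof.
have bil : bilinear_map (fun a b : A => (eps b : K) *: a).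
  split=> [b|a] c y z; last by rewrite epsP scalerDl scalerA.
  by rewrite scalerDr !scalerA mulrC.
have [||phi phiE] := @tens_alg_lift _ _ _ _ _ bil.
- by rewrite eps1 scale1r.
- by move=> a b c d; rewrite epsM -scalerAr -scalerAl scalerA mulrC.
rewrite -phiE; move: x.
have phiT a b : phi (a ⊗ b) = (eps b : K) *: a by rewrite phiE tens_liftE.
have phiD u v : phi (u + v) = phi u + phi v by exact: linearD.
apply: (generated_ext genA (phi := phi \o Delta) (psi := idfun)) => x /=.
by rewrite DeltaE; case: x => i /=; rewrite ?phiD !phiT ?eps1 !epsE;
  rewrite /gen_counit /= ?scale1r ?scale0r ?add0r ?addr0.
Qed.

(** The two laws are carried together: for x u, the left one uses the law for
the generator x and then for u, the right one in the other order. *)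
Lemma comult_antipode (x : A) :
  tens_lift (fun a b => S a * b) (Delta x) = (eps x : K) *: 1 /\
  tens_lift (fun a b => a * S b) (Delta x) = (eps x : K) *: 1.
Proof.
have DM a b : Delta (a * b) = Delta a * Delta b by exact: rmorphM.
have DP c a b : Delta (c *: a + b) = c *: Delta a + Delta b by exact: linearP.
have D1 : Delta 1 = 1 ⊗ 1 by exact: rmorph1.
have bl := bilinear_antipodel S; have br := bilinear_antipoder S.
move: x; apply: genA => [|c u v [ul ur] [vl vr]|x u [ul ur]].
- by rewrite D1 !tens_liftE // S1 mul1r eps1 scale1r.
- rewrite DP (tens_lift_linear bl) (tens_lift_linear br) ul ur vl vr epsP.
  by rewrite scalerDl !scalerA.
have wVK i : g (GenWinv i) * g (GenW i) = 1.
  by rewrite -(qf_wK qg i); apply: (qf_toral qg).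
have w'VK i : g (GenW'inv i) * g (GenW' i) = 1.
  by rewrite -(qf_w'K qg i); apply: (qf_toral qg).
have [gl gr] :
    tens_lift (fun a b => S a * b) (Delta (g x)) = (eps (g x) : K) *: 1 /\
    tens_lift (fun a b => a * S b) (Delta (g x)) = (eps (g x) : K) *: 1.
  rewrite DeltaE epsE /gen_counit.
  case: x => i /=; rewrite ?scale1r ?scale0r ?(tens_liftD bl) ?(tens_liftD br);
    rewrite !tens_liftE // ?S1 !SE /= ?mul1r ?mulr1.
  - by rewrite addNr mulrN mulrA (qf_wK qg) mul1r subrr.
  - by rewrite mulNr -mulrA w'VK mulr1 subrr addNr.
  - by rewrite wVK (qf_wK qg).
  - by rewrite wVK (qf_wK qg).
  - by rewrite w'VK (qf_w'K qg).
  - by rewrite w'VK (qf_w'K qg).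
rewrite DM (antipodel_mul SM _ gl) (antipoder_mul SM _ ur) ul gr epsM !scalerA.
by rewrite [in X in _ /\ X]mulrC.
Qed.

End HopfAxioms.

Theorem proposition1p1 (K : fieldType) (r s : K) (t : lie_type) (n : nat)
    (hK : base_field r s) (hn : valid_rank t n) :
  let e (i : 'I_n) := qgen r s t (GenE i) in
  let f (i : 'I_n) := qgen r s t (GenF i) in
  let w (i : 'I_n) := qgen r s t (GenW i) in
  let wV (i : 'I_n) := qgen r s t (GenWinv i) in
  let w' (i : 'I_n) := qgen r s t (GenW' i) in
  let w'V (i : 'I_n) := qgen r s t (GenW'inv i) in
  exists (Delta : {lrmorphism quantum_group r s t n ->
                     quantum_group r s t n ⊗ quantum_group r s t n})
         (eps : {lrmorphism quantum_group r s t n -> K^o})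
         (S : {linear quantum_group r s t n -> quantum_group r s t n}),
    is_hopf_algebra Delta eps S /\
    (S 1 = 1 /\ forall x y, S (x * y) = S y * S x) /\
    forall i : 'I_n,
      [/\ Delta (w i) = w i ⊗ w i,
          Delta (wV i) = wV i ⊗ wV i,
          Delta (w' i) = w' i ⊗ w' i &
          Delta (w'V i) = w'V i ⊗ w'V i] /\
      [/\ Delta (e i) = e i ⊗ (1 : quantum_group r s t n) + w i ⊗ e i &
          Delta (f i) = (1 : quantum_group r s t n) ⊗ f i + f i ⊗ w' i] /\
      [/\ eps (w i) = 1, eps (wV i) = 1, eps (w' i) = 1 & eps (w'V i) = 1] /\
      [/\ eps (e i) = 0 & eps (f i) = 0] /\
      [/\ S (w i) = wV i, S (wV i) = w i, S (w' i) = w'V i & S (w'V i) = w' i] /\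
      [/\ S (e i) = - (wV i * e i) & S (f i) = - (f i * w'V i)].
Proof.
have [r0 s0] := base_field_neq0 hK.
have qg := qgen_family r s t n.
have [Delta DeltaE] := quantum_lift (comult_family r0 s0 hn qg).
have [eps epsE] := quantum_lift (counit_family r s t n).
have [phi phiE] := quantum_lift (antipode_family r0 s0 hn qg).
have [S Sphi] := lrmorphism_converse_linear phi.
have SE x : S (qgen r s t x) = antipode_gen (qgen r s t (n := n)) x.
  by rewrite Sphi phiE.
have S1 : S 1 = 1 by rewrite Sphi; exact: (rmorph1 phi).
have SM x y : S (x * y) = S y * S x by rewrite !Sphi; exact: (rmorphM phi x y).
have gen := @quantum_generated K r s t n.
move=> e f w wV w' w'V; exists Delta, eps, S; split; last first.
  by do 2!split=> //; rewrite ?DeltaE ?epsE ?SE.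
split=> x.
- exact: (comult_coassoc gen DeltaE).
- exact: (comult_counitl gen DeltaE epsE).
- exact: (comult_counitr gen DeltaE epsE).
- exact: (comult_antipode gen qg DeltaE epsE SE S1 SM x).1.
- exact: (comult_antipode gen qg DeltaE epsE SE S1 SM x).2.
Qed.
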